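(* Let $(\Omega,\mathcal I,\mathcal J,q,g)$ be a finite two-person zero-sum stochastic game, and for $\lambda\in(0,1]$ let $v_\lambda=(v_\lambda(\omega))_{\omega\in\Omega}\in\mathbb R^\Omega$ be the vector of values of the $\lambda$-discounted games. Then the limit of $(v_\lambda)_\lambda$ in $\mathbb R^\Omega$, as $\lambda$ tends to $0$, exists. Moreover, there exists $\mathbf x=(\mathbf c,\mathbf e)\in\mathbf X$ such that the induced canonical family $(\mathbf x_\lambda)_{\lambda\in(0,1]}$ of stationary strategies of player 1 is asymptotically optimal, i.e. for all $\varepsilon>0$ there exists $\lambda_0\in(0,1]$ such that $$\gamma_\lambda(\omega,\mathbf x_\lambda,y)\ \ge\ \lim_{\lambda'\to0}v_{\lambda'}(\omega)-\varepsilon,\qquad \forall\,\omega\in\Omega,\ \forall\, y\in\Delta(\mathcal J)^\Omega,\ \forall\,\lambda\in(0,\lambda_0).$$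
   Context: For a finite set $X$, $\Delta(X)$ denotes the set of probability distributions on $X$. A finite two-person zero-sum stochastic game is a 5-tuple $(\Omega,\mathcal I,\mathcal J,q,g)$ where $\Omega$ (states), $\mathcal I$ (actions of player 1) and $\mathcal J$ (actions of player 2) are finite nonempty sets, $g:\Omega\times\mathcal I\times\mathcal J\to[0,1]$ is the payoff function and $q:\Omega\times\mathcal I\times\mathcal J\to\Delta(\Omega)$ is the transition function. The functions $g$ and $q$ are bilinearly extended to $\Omega\times\Delta(\mathcal I)\times\Delta(\mathcal J)$. For $\lambda\in(0,1]$ and $\omega\in\Omega$, the discounted game $\Gamma_\lambda(\omega)$ is played as follows: $\omega_1=\omega$; at each stage $m\ge1$, knowing the current state $\omega_m$, the players choose actions $(i_m,j_m)\in\mathcal I\times\mathcal J$, and $\omega_{m+1}$ is drawn from $q(\cdot|\omega_m,i_m,j_m)$; at the end player 1 receives $\sum_{m\ge1}\lambda(1-\lambda)^{m-1}g(\omega_m,i_m,j_m)$ from player 2. Its value is denoted $v_\lambda(\omega)$. The vector $v_\lambda=(v_\lambda(\omega))_{\omega\in\Omega}$ is the unique fixed point $v_\lambda=\Phi(\lambda,v_\lambda)$ of the Shapley operator, defined for $f\in\mathbb R^\Omega$ by $$\Phi(\lambda,f)(\omega)=\mathrm{val}_{(s,t)\in\Delta(\mathcal I)\times\Delta(\mathcal J)}\Big\{\lambda g(\omega,s,t)+(1-\lambda)\sum_{\omega'\in\Omega}q(\omega'|\omega,s,t)f(\omega')\Big\},$$ where $\mathrm{val}$ is the minmax value (player 1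 chooses $s$ and maximizes, player 2 chooses $t$ and minimizes). A stationary strategy of player 1 (resp. 2) is an element $x\in\Delta(\mathcal I)^\Omega$ (resp. $y\in\Delta(\mathcal J)^\Omega$); $x^i(\omega)$ is the probability of playing $i$ at state $\omega$. The expected payoff induced by $(x,y)$ in $\Gamma_\lambda(\omega)$ is $$\gamma_\lambda(\omega,x,y)=\sum_{\omega'\in\Omega}\ \sum_{m\ge1}\lambda(1-\lambda)^{m-1}Q^{m-1}(\omega,\omega')\,g(\omega',x(\omega'),y(\omega')),$$ where $Q=(q(\omega'|\omega,x(\omega),y(\omega)))_{(\omega,\omega')\in\Omega^2}$ and $0^0=1$. Let $\mathbb R_+=[0,\infty)$, $\mathbb R_+^*=(0,\infty)$ and $$\mathbf X=\Big\{(\mathbf c,\mathbf e)\in(\mathbb R_+^*\times\mathbb R_+)^{\Omega\times\mathcal I}\ :\ \forall\omega\in\Omega,\ \sum_{i\in\mathcal I,\ \mathbf e(\omega,i)=0}\mathbf c(\omega,i)=1\Big\}.$$ Each $\mathbf x=(\mathbf c,\mathbf e)\in\mathbf X$ induces a canonical family $(\mathbf x_\lambda)_{\lambda\in(0,1]}$ of stationary strategies of player 1: $$\mathbf x_\lambda^i(\omega)=\frac{\mathbf c(\omega,i)\lambda^{\mathbf e(\omega,i)}}{\sum_{i'\in\mathcal I}\mathbf c(\omega,i')\lambda^{\mathbf e(\omega,i')}},\qquad(\omega,i)\in\Omega\times\mathcal I.$$ *)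

(* Defs.v *)
From HB Require Import structures.
From mathcomp Require Import all_boot all_order all_algebra.
From mathcomp Require Import all_classical all_reals all_analysis.
Set Implicit Arguments.
Unset Strict Implicit.
Unset Printing Implicit Defensive.
Import Order.TTheory GRing.Theory Num.Theory.
Import numFieldNormedType.Exports.
Local Open Scope classical_set_scope.
Local Open Scope ring_scope.

(* [dist R X] is Delta(X). *)
Record dist (R : realType) (X : finType) := Dist {
  dist_fun :> X -> R;
  dist_ge0 : forall x, 0 <= dist_fun x;
  dist_sum1 : \sum_x dist_fun x = 1 }.

Record stochastic_game (R : realType) := StochasticGame {
  state : finType;
  act1 : finType;
  act2 : finType;
  payoff : state -> act1 -> act2 -> R;
  transition : state -> act1 -> act2 -> dist R state;
  state_nonempty : (0 < #|state|)%N;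
  act1_nonempty : (0 < #|act1|)%N;
  act2_nonempty : (0 < #|act2|)%N;
  payoff_in01 : forall w i j, 0 <= payoff w i j <= 1 }.

Section Values.
Variables (R : realType) (S T : Type) (f : S -> T -> R).

Definition maxmin : R := sup (range (fun s => inf (range (fun t => f s t)))).
Definition minmax : R := inf (range (fun t => sup (range (fun s => f s t)))).

Definition is_value (a : R) : Prop := maxmin = a /\ minmax = a.

(* The common value of [maxmin] and [minmax]; arbitrary if they differ. *)
Definition game_value : R := [get a | is_value a].
End Values.

Section Game.
Variables (R : realType) (G : stochastic_game R).
Local Notation Omega := (state G).
Local Notation I := (act1 G).
Local Notation J := (act2 G).

Definition payoff_mixed (w : Omega) (s : dist R I) (t : dist R J) : R :=
  \sum_i \sum_j s i * t j * payoff w i j.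

Definition transition_mixed (w : Omega) (s : dist R I) (t : dist R J)
    (w' : Omega) : R :=
  \sum_i \sum_j s i * t j * transition w i j w'.

(* Past stages (w_1, i_1, j_1), ..., (w_{m-1}, i_{m-1}, j_{m-1}), in
   chronological order. A behaviour strategy plays at stage m according to
   this history and the current state w_m. *)
Definition history : Type := seq (Omega * I * J).
Definition behaviour1 : Type := history -> Omega -> dist R I.
Definition behaviour2 : Type := history -> Omega -> dist R J.

(* Expectation of the payoff received m stages later (the current one if
   m = 0), given the past h and the current state w. *)
Fixpoint expected_payoff (sigma : behaviour1) (tau : behaviour2)
    (m : nat) (h : history) (w : Omega) : R :=
  match m with
  | 0%N => payoff_mixed w (sigma h w) (tau h w)
  | m'.+1 => \sum_i \sum_j sigma h w i * tau h w j *
      \sum_w' transition w i j w' *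
        expected_payoff sigma tau m' (rcons h (w, i, j)) w'
  end.

(* The index m is shifted: stage m.+1 has weight lambda (1 - lambda)^m. *)
Definition discounted_payoff (lambda : R) (w : Omega)
    (sigma : behaviour1) (tau : behaviour2) : R :=
  limn (series (fun m =>
    lambda * (1 - lambda) ^+ m * expected_payoff sigma tau m [::] w)).

Definition discounted_value (lambda : R) (w : Omega) : R :=
  game_value (discounted_payoff lambda w).

Definition stationary1 : Type := Omega -> dist R I.
Definition stationary2 : Type := Omega -> dist R J.

(* Rows and columns are indexed by states through [enum_val]. *)
Definition transition_mx (x : stationary1) (y : stationary2) :
    'M[R]_(#|Omega|) :=
  \matrix_(k, l)
    transition_mixed (enum_val k) (x (enum_val k)) (y (enum_val k))
      (enum_val l).

Definition stationary_payoff (lambda : R) (w : Omega)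
    (x : stationary1) (y : stationary2) : R :=
  \sum_w' limn (series (fun m =>
    lambda * (1 - lambda) ^+ m *
    (transition_mx x y ^+ m) (enum_rank w) (enum_rank w') *
    payoff_mixed w' (x w') (y w'))).

(* The set of pairs (c, e) written bold X. *)
Record canonical_param := CanonicalParam {
  coef : Omega -> I -> R;
  expo : Omega -> I -> R;
  coef_gt0 : forall w i, 0 < coef w i;
  expo_ge0 : forall w i, 0 <= expo w i;
  coef_sum1 : forall w, \sum_(i | expo w i == 0) coef w i = 1 }.

Section Canonical.
Variables (p : canonical_param) (lambda : R).

Definition canonical_weight (w : Omega) (i : I) : R :=
  coef p w i * lambda `^ expo p w i.

Definition canonical_prob (w : Omega) (i : I) : R :=
  canonical_weight w i / \sum_i' canonical_weight w i'.

Hypothesis lambda_gt0 : 0 < lambda.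

Lemma canonical_weight_gt0 w i : 0 < canonical_weight w i.
Proof. by rewrite mulr_gt0 ?coef_gt0 ?powR_gt0. Qed.

Lemma canonical_weight_sum_gt0 w : 0 < \sum_i canonical_weight w i.
Proof.
have /card_gt0P[i0 _] := act1_nonempty G.
rewrite (bigD1 i0)//= ltr_pwDl ?canonical_weight_gt0//.
by apply: sumr_ge0 => i _; exact/ltW/canonical_weight_gt0.
Qed.

Lemma canonical_prob_ge0 w i : 0 <= canonical_prob w i.
Proof.
by rewrite divr_ge0// ltW ?canonical_weight_gt0 ?canonical_weight_sum_gt0.
Qed.

Lemma canonical_prob_sum1 w : \sum_i canonical_prob w i = 1.
Proof.
by rewrite -mulr_suml divff// gt_eqF// canonical_weight_sum_gt0.
Qed.

Definition canonical_strategy : stationary1 := fun w =>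
  Dist (canonical_prob_ge0 w) (canonical_prob_sum1 w).
End Canonical.

Definition limit_value (w : Omega) : R :=
  lim (discounted_value lambda w @[lambda --> 0^'+]).

Definition asymptotically_optimal (p : canonical_param) : Prop :=
  forall eps : R, 0 < eps -> exists lambda0 : R, 0 < lambda0 <= 1 /\
    forall (w : Omega) (y : stationary2) (lambda : R)
      (lambda_gt0 : 0 < lambda), lambda < lambda0 ->
      stationary_payoff lambda w (canonical_strategy p lambda_gt0) y >=
        limit_value w - eps.
End Game.

Arguments canonical_param {R} G.
Arguments discounted_value {R} G lambda w.

(* Main.v *)
Require Import Defs.
From mathcomp Require Import all_boot all_order all_algebra.
From mathcomp Require Import all_classical all_reals all_analysis.
From mathcomp Require Import ring lra.
Import Order.TTheory GRing.Theory Num.Theory.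
Import numFieldNormedType.Exports.
Local Open Scope classical_set_scope.
Local Open Scope ring_scope.

(** Against a fixed stationary strategy of player 1 the opponent has a pure
    stationary best reply ([pure_best_reply]), and there are finitely many of
    these. For each of them, solving the balance equations of the induced
    Markov chain by eliminating one state after the other, without any
    subtraction ([state_elimination]), writes the payoff as a ratio of two
    posynomials, i.e. polynomials with positive coefficients, in
    lambda / (1 - lambda) and the probabilities x(w, i) ([gamma_posynomial]).
    The limit of such a ratio depends only on the relative sizes of the
    finitely many monomials that occur in it ([posynomial_ratio_transfer]).

    Let U be an ultrafilter refining the right neighbourhoods of 0. Every
    bounded function of lambda converges along U; let L be the limit of the
    values. For each lambda choose a nearly optimal stationary strategy x_lambda
    with positive probabilities ([near_optimal_interior]). Along U, the logarithm
    of a ratio of two monomials evaluated at x_lambda converges in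
    [-oo, +oo]. A short argument of linear algebra ([ultra_exponents]) yields
    exponents e and log-coefficients b such that the power laws
    exp(b) lambda^e have the same limits for the finitely many monomials in
    question; since the probabilities x_lambda(w, .) lie in a simplex, these
    e and exp(b) form a canonical parameter. The induced canonical family
    therefore has, against every pure stationary reply, the same limit payoff as
    x_lambda along U, which is at least L, and so it guarantees L - eps for all
    small lambda ([canonical_from_ultrafilter]).

    In particular liminf v_lambda >= L for every such U: any two limit
    points of the values dominate each other, so the values converge, and the
    canonical family attached to any U is asymptotically optimal.

    The values themselves are obtained from Shapley's equation, which rests on
    the minmax theorem for matrix games ([saddle_exists]). *)

Set Implicit Arguments.
Unset Strict Implicit.

(** * Convergence along ultrafilters *)

(** A cluster point exists by compactness, and an ultrafilter converges to each
    of its cluster points. *)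
Lemma ultra_cvg_segment (R : realType) (T : Type) (U : set_system T)
    {UU : UltraFilter U} (f : T -> R) (a b : R) :
  (\forall t \near U, a <= f t <= b) -> exists l : R, f t @[t --> U] --> l.
Proof.
move=> fab.
have fab' : (f @ U) `[a, b]%classic.
  by near=> t; rewrite /= in_itv /=; near: t.
have [l [_ fl]] := @segment_compact R a b (f @ U) _ fab'.
exists l => B Bl; have [//|UnB] := in_ultra_setVsetC (f @^-1` B) UU.
by have [y [nBy By]] := fl (~` B) B UnB Bl.
Unshelve. all: by end_near. Qed.

Lemma ultra_cvg_dist (R : realType) (T : Type) (U : set_system T)
    {UU : UltraFilter U} (X : finType) (d : T -> dist R X) :
  exists d0 : dist R X, forall x, d t x @[t --> U] --> d0 x.
Proof.
have d01 t x : 0 <= d t x <= 1.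
  rewrite dist_ge0 /= -(dist_sum1 (d t)) (bigD1 x) //= lerDl.
  by apply: sumr_ge0 => ? _; exact: dist_ge0.
have dcvg x : exists l : R, d t x @[t --> U] --> l.
  by apply: (@ultra_cvg_segment _ _ _ _ _ 0 1); apply: nearW => t.
have [d0 d0P] := choice dcvg.
have d0_ge0 x : 0 <= d0 x.
  rewrite -(cvg_lim _ (d0P x)) //; apply: limr_ge; first by apply/cvg_ex; exists (d0 x).
  by apply: nearW => t; exact: dist_ge0.
have d0_sum : \sum_x d0 x = 1.
  have : \sum_x d t x @[t --> U] --> \sum_x d0 x.
    by apply: cvg_big => // ; exact: add_continuous.
  under eq_fun do rewrite dist_sum1.
  move/cvg_lim => <- //; apply: lim_cst => //.
by exists (Dist d0_ge0 d0_sum).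
Qed.

(** * The minmax theorem for matrix games *)

Section FiniteDistributions.
Variables (R : realType) (X : finType).

Lemma pure_ge0 (x0 x : X) : 0 <= (x == x0)%:R :> R.
Proof. exact: ler0n. Qed.

Lemma pure_sum1 (x0 : X) : \sum_x (x == x0)%:R = 1 :> R.
Proof. by rewrite (bigD1 x0) //= eqxx big1 ?addr0 // => x /negPf ->. Qed.

Definition pure_action (x0 : X) : dist R X := Dist (pure_ge0 x0) (pure_sum1 x0).

Lemma sum_pure (x0 : X) (f : X -> R) : \sum_x pure_action x0 x * f x = f x0.
Proof.
rewrite (bigD1 x0) //= eqxx mul1r big1 ?addr0 // => x /negPf ->.
by rewrite mul0r.
Qed.

Variables (h : R) (h01 : 0 <= h <= 1).

Lemma mixture_ge0 (d d' : dist R X) x : 0 <= (1 - h) * d x + h * d' x.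
Proof.
by case/andP: h01 => h0 h1; rewrite addr_ge0 ?mulr_ge0 ?dist_ge0 ?subr_ge0.
Qed.

Lemma mixture_sum1 (d d' : dist R X) : \sum_x ((1 - h) * d x + h * d' x) = 1.
Proof. by rewrite big_split /= -!mulr_sumr !dist_sum1 !mulr1 subrK. Qed.

Definition mixture (d d' : dist R X) : dist R X :=
  Dist (mixture_ge0 d d') (mixture_sum1 d d').

Lemma sum_mixture (d d' : dist R X) (f : X -> R) :
  \sum_x mixture d d' x * f x =
  (1 - h) * (\sum_x d x * f x) + h * (\sum_x d' x * f x).
Proof.
rewrite !mulr_sumr -big_split /=; apply: eq_bigr => x _.
by rewrite mulrDl !mulrA.
Qed.

End FiniteDistributions.

(** Compactness of the simplex, in the form needed to minimise a continuous
    function on it: continuity is required along ultrafilters only, so that a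
    minimising sequence has a limit by [ultra_cvg_dist]. *)
Lemma dist_argmin (R : realType) (X : finType) (phi : (X -> R) -> R) :
  (0 < #|X|)%N -> (forall d : dist R X, 0 <= phi d) ->
  (forall (T : Type) (U : set_system T), UltraFilter U ->
    forall (d : T -> dist R X) (d0 : dist R X),
    (forall x, d t x @[t --> U] --> d0 x) ->
    phi (d t) @[t --> U] --> phi d0) ->
  exists d0 : dist R X, forall d : dist R X, phi d0 <= phi d.
Proof.
move=> /card_gt0P[x0 _] phi0 phi_cont.
pose S := range (fun d : dist R X => phi d).
have infS : has_inf S.
  by split; [exists (phi (pure_action R x0)), (pure_action R x0)|exists 0 => _ [d _ <-]].
have nearmin n : exists d : dist R X, phi d < inf S + n.+1%:R^-1.
  have [|_ [d _ <-] ltd] := @inf_adherent R S n.+1%:R^-1 _ infS.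
    by rewrite invr_gt0 ltr0n.
  by exists d.
have [d dP] := choice nearmin.
have [U [UU leU]] := @ultraFilterLemma nat \oo _.
have [d0 dd0] := ultra_cvg_dist (U := U) d.
have lim_bound : inf S + n.+1%:R^-1 @[n --> U] --> inf S + 0.
  apply: cvgD; first exact: cvg_cst.
  by apply: cvg_trans (@cvg_harmonic R); exact: cvg_app.
exists d0 => d'; apply: (@le_trans _ _ (inf S)); last first.
  by apply: ge_inf; [case: infS|exists d'].
rewrite -[leRHS]addr0.
apply: ler_cvg_to (phi_cont _ _ _ _ _ dd0) lim_bound _.
by apply: nearW => n; exact/ltW/dP.
Qed.

(** First-order optimality at a minimiser over the simplex of the squared norm
    of the positive part of [A t]: unless that positive part vanishes, it is,
    up to scaling, a mixed row that earns a positive payoff against every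
    column. *)
Lemma matrix_alternative (R : realType) (I J : finType) (A : I -> J -> R) :
  (0 < #|J|)%N ->
  (exists t : dist R J, forall i, \sum_j t j * A i j <= 0) \/
  (exists s : dist R I, forall j, 0 < \sum_i s i * A i j).
Proof.
move=> J0.
pose a (t : J -> R) i := \sum_j t j * A i j.
pose phi (t : J -> R) := \sum_i (Num.max 0 (a t i)) ^+ 2.
have [||t tmin] := @dist_argmin R J phi J0.
- by move=> t; apply: sumr_ge0 => i _; exact: sqr_ge0.
- move=> T U UU d d0 dd0; apply: cvg_big => [|i _]; first exact: add_continuous.
  have cont_sqr : {for a d0 i, continuous (fun x : R => Num.max 0 x ^+ 2)}.
    apply: (@continuous_comp _ _ _ (fun x : R => Num.max 0 x) (fun y => y ^+ 2)).
      by apply: (@continuous_max R R (cst 0) id); [exact: cst_continuous|exact: cvg_id].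
    exact: exprn_continuous.
  apply: (continuous_cvg _ cont_sqr).
  apply: cvg_big => [|j _]; first exact: add_continuous.
  exact: cvgMr_tmp.
pose p i := Num.max 0 (a t i).
have p0 i : 0 <= p i by rewrite le_max lexx.
have [sp0|sp_neq0] := eqVneq (\sum_i p i) 0.
  left; exists t => i.
  have /(_ i isT) := @psumr_eq0P _ _ _ _ (fun i _ => p0 i) sp0.
  by rewrite /p => pi0; rewrite -/(a t i) -pi0 le_max lexx orbT.
right.
have sp : 0 < \sum_i p i by rewrite lt_def sp_neq0 sumr_ge0.
have s_ge0 i : 0 <= p i / \sum_i p i by rewrite divr_ge0 // ltW.
have s_sum : \sum_i p i / \sum_i p i = 1 by rewrite -mulr_suml divff.
exists (Dist s_ge0 s_sum) => j /=.
under eq_bigr do rewrite mulrAC.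
rewrite -mulr_suml divr_gt0 //.
pose D := \sum_i p i * (A i j - a t i).
pose C := \sum_i (A i j - a t i) ^+ 2.
have C0 : 0 <= C by apply: sumr_ge0 => i _; exact: sqr_ge0.
(* Moving from [t] towards the pure action [j] by [h] changes the objective by
   at most [2 h D + h^2 C], so minimality of [t] forces [0 <= D]. *)
have small_step h : 0 <= h <= 1 -> 0 <= 2 * h * D + h ^+ 2 * C.
  move=> h01; have := tmin (mixture h01 t (pure_action R j)).
  have -> : 2 * h * D + h ^+ 2 * C =
      \sum_i (p i + h * (A i j - a t i)) ^+ 2 - phi t.
    rewrite /D /C /phi !mulr_sumr -big_split /= -sumrB; apply: eq_bigr => i _.
    by rewrite -/(p i); ring.
  rewrite subr_ge0 => /le_trans; apply; apply: ler_sum => i _.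
  have -> : a (mixture h01 t (pure_action R j)) i = a t i + h * (A i j - a t i).
    by rewrite /a sum_mixture sum_pure; ring.
  have pa : a t i <= p i by rewrite le_max lexx orbT.
  have [le0|/ltW ge0] := leP (a t i + h * (A i j - a t i)) 0.
    by rewrite expr0n /= sqr_ge0.
  by rewrite ler_sqr ?nnegrE // ?lerD2r // (le_trans ge0) // lerD2r.
have D0 : 0 <= D.
  rewrite leNgt; apply/negP => Dlt0.
  (* The step [h = - D / (C - D)] is in the unit interval and makes
     [D + h * C = h * D]. *)
  have CD : 0 < C - D by rewrite subr_gt0 (lt_le_trans Dlt0).
  have h0 : 0 < - D / (C - D) by rewrite divr_gt0 // oppr_gt0.
  have h1 : - D / (C - D) <= 1 by rewrite ler_pdivrMr // mul1r lerDr.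
  have := small_step (- D / (C - D)); rewrite h1 ltW // => /(_ isT).
  set h := - D / (C - D) in h0 h1 *.
  have hCD : h * (C - D) = - D by rewrite /h divfK // gt_eqF.
  have -> : 2 * h * D + h ^+ 2 * C = h * (2 * D + h * (C - D) + h * D) by ring.
  rewrite hCD mulr_natl mulr2n addrK pmulr_rge0 // leNgt => /negP; apply.
  by rewrite -[ltRHS]addr0 ltrD // pmulr_rlt0.
have : 0 < \sum_i p i * p i.
  have [i pi] : exists i, 0 < p i.
    apply/existsP; apply: contraT; rewrite negb_exists => /forallP pneg.
    case/negP: sp_neq0; apply/eqP/big1 => i _; apply/eqP.
    by rewrite eq_le p0 leNgt pneg.
  rewrite (bigD1 i) //= ltr_pwDl ?mulr_gt0 //.
  by apply: sumr_ge0 => k _; rewrite mulr_ge0.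
have -> : \sum_i p i * A i j = D + \sum_i p i * p i.
  rewrite /D -big_split /=; apply: eq_bigr => i _.
  by rewrite /p; case: (leP (a t i) 0) => _; ring.
by move=> pp; rewrite ltr_wpDl.
Qed.

Lemma positive_lower_bound (R : realType) (X : finType) (f : X -> R) :
  (forall x, 0 < f x) -> exists2 delta, 0 < delta & forall x, delta <= f x.
Proof.
move=> f0; case: (pickP (@predT X)) => [x0 _|X0].
  by have [x _ xmin] := @arg_minP _ _ _ x0 predT f isT; exists (f x) => // y; exact: xmin.
by exists 1 => // x; have := X0 x.
Qed.

Section BilinearPayoff.
Variables (R : realType) (I J : finType).
Implicit Types (A B : I -> J -> R) (s : dist R I) (t : dist R J).

Definition bilinear A s t : R := \sum_i \sum_j s i * t j * A i j.

Lemma bilinear_rows A s t : bilinear A s t = \sum_i s i * \sum_j t j * A i j.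
Proof.
by apply: eq_bigr => i _; rewrite mulr_sumr; apply: eq_bigr => j _; rewrite mulrA.
Qed.

Lemma bilinear_cols A s t : bilinear A s t = \sum_j t j * \sum_i s i * A i j.
Proof.
rewrite /bilinear exchange_big; apply: eq_bigr => j _.
by rewrite mulr_sumr; apply: eq_bigr => i _; rewrite mulrA (mulrC (t j)).
Qed.

Lemma le_bilinear A B s t :
  (forall i j, A i j <= B i j) -> bilinear A s t <= bilinear B s t.
Proof.
move=> AB; apply: ler_sum => i _; apply: ler_sum => j _.
by rewrite ler_wpM2l ?mulr_ge0 ?dist_ge0.
Qed.

Lemma bilinear_cst c s t : bilinear (fun _ _ => c) s t = c.
Proof.
rewrite bilinear_rows; under eq_bigr do rewrite -mulr_suml dist_sum1 mul1r.
by rewrite -mulr_suml dist_sum1 mul1r.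
Qed.

Lemma bilinearD A B s t :
  bilinear (fun i j => A i j + B i j) s t = bilinear A s t + bilinear B s t.
Proof.
rewrite -big_split; apply: eq_bigr => i _; rewrite -big_split.
by apply: eq_bigr => j _; rewrite mulrDr.
Qed.

Lemma bilinearZ c A s t :
  bilinear (fun i j => c * A i j) s t = c * bilinear A s t.
Proof.
rewrite mulr_sumr; apply: eq_bigr => i _; rewrite mulr_sumr.
by apply: eq_bigr => j _; rewrite mulrCA.
Qed.

Lemma ge_dist_average t (f : J -> R) c : (forall j, c <= f j) -> c <= \sum_j t j * f j.
Proof.
move=> cf; rewrite -[leLHS]mul1r -(dist_sum1 t) mulr_suml.
by apply: ler_sum => j _; rewrite ler_wpM2l ?dist_ge0.
Qed.

Lemma le_dist_average t (f : J -> R) c : (forall j, f j <= c) -> \sum_j t j * f j <= c.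
Proof.
move=> cf; rewrite -[leRHS]mul1r -(dist_sum1 t) mulr_suml.
by apply: ler_sum => j _; rewrite ler_wpM2l ?dist_ge0.
Qed.
End BilinearPayoff.

Definition saddle (R : realType) (I J : finType) (A : I -> J -> R)
    (v : R) (s : dist R I) (t : dist R J) : Prop :=
  (forall j, v <= \sum_i s i * A i j) /\ (forall i, \sum_j t j * A i j <= v).

(** The value is the supremum of the payoffs that player 1 can guarantee. Both
    optimal strategies come from [matrix_alternative] at that level: its other
    branch would let player 1 guarantee strictly more than the supremum, or
    player 2 strictly less. *)
Lemma saddle_exists (R : realType) (I J : finType) (A : I -> J -> R) :
  (0 < #|I|)%N -> (0 < #|J|)%N -> exists v s t, saddle A v s t.
Proof.
move=> I0 J0; have /card_gt0P[i0 _] := I0; have /card_gt0P[j0 _] := J0.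
pose S := [set v : R | exists s : dist R I, forall j, v <= \sum_i s i * A i j].
have supS : has_sup S.
  split.
    exists (- \sum_j `|A i0 j|), (pure_action R i0) => j.
    rewrite sum_pure lerNl (le_trans (ler_norm _)) // normrN (bigD1 j) //=.
    by rewrite lerDl sumr_ge0.
  exists (\sum_i `|A i j0|) => v [s /(_ j0)] /le_trans; apply.
  apply: le_dist_average => i; rewrite (le_trans (ler_norm _)) // (bigD1 i) //=.
  by rewrite lerDl sumr_ge0.
have shift (X : finType) (d : dist R X) (f : X -> R) :
    \sum_x d x * (f x - sup S) = \sum_x d x * f x - sup S.
  under eq_bigr do rewrite mulrBr.
  by rewrite sumrB -mulr_suml dist_sum1 mul1r.
have [t tP] : exists t : dist R J, forall i, \sum_j t j * A i j <= sup S.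
  have [[t tP]|[s sP]] := matrix_alternative (fun i j => A i j - sup S) J0.
    by exists t => i; rewrite -subr_le0 -shift.
  have [delta d0 dP] := positive_lower_bound sP.
  have /(ub_le_sup (proj2 supS)) : S (sup S + delta).
    by exists s => j; have := dP j; rewrite shift lerBrDl.
  by rewrite -subr_ge0 opprD addrA subrr sub0r oppr_ge0 leNgt d0.
have [s sP] : exists s : dist R I, forall j, sup S <= \sum_i s i * A i j.
  have [[s sP]|[u uP]] := matrix_alternative (fun j i => - (A i j - sup S)) I0.
    exists s => j; rewrite -subr_ge0 -shift -oppr_le0 -sumrN.
    by under eq_bigr do rewrite -mulrN.
  have [delta d0 dP] := positive_lower_bound uP.
  have [v [s sP] ltv] := sup_adherent d0 supS.
  have := ge_dist_average u sP; rewrite -bilinear_cols bilinear_rows => vle.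
  have : \sum_i s i * (\sum_j u j * A i j) <= sup S - delta.
    apply: le_dist_average => i; have := dP i.
    under eq_bigr do rewrite mulrN; rewrite sumrN shift; lra.
  by move=> /(le_trans vle); rewrite leNgt ltv.
by exists (sup S), s, t.
Qed.

Lemma le_saddle (R : realType) (I J : finType) (A B : I -> J -> R) v s t v' s' t' :
  (forall i j, A i j <= B i j) -> saddle A v s t -> saddle B v' s' t' -> v <= v'.
Proof.
move=> AB [vA _] [_ vB]; apply: (@le_trans _ _ (bilinear A s t')).
  by rewrite bilinear_cols; exact: ge_dist_average.
apply: le_trans (le_bilinear _ _ AB) _.
by rewrite bilinear_rows; exact: le_dist_average.
Qed.

(** The strategies [s0] and [t0] squeeze both the maxmin and the minmax between
    [v] and [v]; boundedness of the payoff makes all suprema and infima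
    genuine. *)
Lemma saddle_is_value (R : realType) (S T : Type) (f : S -> T -> R) (s0 : S) (t0 : T) v :
  (forall s t, 0 <= f s t <= 1) ->
  (forall t, v <= f s0 t) -> (forall s, f s t0 <= v) -> game_value f = v.
Proof.
move=> f01 vf fv.
have inf_le s t : inf (range (f s)) <= f s t.
  apply: ge_inf; last by exists t.
  by exists 0 => _ [t' _ <-]; case/andP: (f01 s t').
have le_sup_ s t : f s t <= sup (range (f^~ t)).
  apply: ub_le_sup; last by exists s.
  by exists 1 => _ [s' _ <-]; case/andP: (f01 s' t).
have value_v : is_value f v.
  split; apply/eqP; rewrite eq_le; apply/andP; split.
  - apply: ge_sup; first by exists (inf (range (f s0))), s0.
    by move=> _ [s _ <-]; exact: le_trans (inf_le s t0) (fv s).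
  - apply: (@le_trans _ _ (inf (range (f s0)))).
      by apply: lb_le_inf; [exists (f s0 t0), t0|move=> _ [t _ <-]].
    apply: ub_le_sup; last by exists s0.
    by exists v => _ [s _ <-]; exact: le_trans (inf_le s t0) (fv s).
  - apply: (@le_trans _ _ (sup (range (f^~ t0)))).
      apply: ge_inf; last by exists t0.
      by exists v => _ [t _ <-]; exact: le_trans (vf t) (le_sup_ s0 t).
    by apply: ge_sup; [exists (f s0 t0), s0|move=> _ [s _ <-]].
  - apply: lb_le_inf; first by exists (sup (range (f^~ t0))), t0.
    by move=> _ [t _ <-]; exact: le_trans (vf t) (le_sup_ s0 t).
by apply: (@xget_unique _ point [set a | is_value f a]) => // a [<- _]; case: value_v.
Qed.

(** * Shapley's equation and discounted payoffs *)

Section DiscountedGame.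
Variables (R : realType) (G : stochastic_game R).
Local Notation Omega := (state G).
Local Notation I := (act1 G).
Local Notation J := (act2 G).
Implicit Types (w : Omega) (x : stationary1 G) (y : stationary2 G).

Definition shapley_matrix (lambda : R) (f : Omega -> R) w (i : I) (j : J) : R :=
  lambda * payoff w i j + (1 - lambda) * \sum_w' transition w i j w' * f w'.

Definition shapley (lambda : R) x y (f : Omega -> R) w : R :=
  bilinear (shapley_matrix lambda f w) (x w) (y w).

Lemma payoff_mixedE w s t : payoff_mixed w s t = bilinear (payoff w) s t.
Proof. by []. Qed.

Lemma payoff_mixed01 w s t : 0 <= payoff_mixed w s t <= 1.
Proof.
rewrite payoff_mixedE; apply/andP; split.
  rewrite -[leLHS](bilinear_cst 0 s t); apply: le_bilinear => i j.
  by case/andP: (payoff_in01 w i j).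
rewrite -[leRHS](bilinear_cst 1 s t); apply: le_bilinear => i j.
by case/andP: (payoff_in01 w i j).
Qed.

Variable lambda : R.
Hypothesis lambda01 : 0 < lambda <= 1.

Let lambda_gt0 : 0 < lambda. Proof. by case/andP: lambda01. Qed.
Let lambda_ge0 : 0 <= lambda. Proof. exact: ltW. Qed.
Let mu_ge0 : 0 <= 1 - lambda. Proof. by rewrite subr_ge0; case/andP: lambda01. Qed.
Let mu_lt1 : `|1 - lambda| < 1.
Proof. by rewrite ger0_norm // ltrBlDr ltrDl. Qed.

Lemma le_shapley_matrix f f' w i j : (forall w', f w' <= f' w') ->
  shapley_matrix lambda f w i j <= shapley_matrix lambda f' w i j.
Proof.
move=> ff'; rewrite lerD2l ler_wpM2l //; apply: ler_sum => w' _.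
by rewrite ler_wpM2l ?dist_ge0.
Qed.

(** Knaster-Tarski: the greatest subsolution with values in [0, 1] of the
    monotone Shapley operator is a fixed point of it. *)
Lemma shapley_equation : exists (V : Omega -> R) x y,
  (forall w, 0 <= V w <= 1) /\
  (forall w, saddle (shapley_matrix lambda V w) (V w) (x w) (y w)).
Proof.
have [val valP] := choice (fun fw : (Omega -> R) * Omega =>
  saddle_exists (shapley_matrix lambda fw.1 fw.2) (act1_nonempty G) (act2_nonempty G)).
have val_mono f f' w : (forall w', f w' <= f' w') -> val (f, w) <= val (f', w).
  move=> ff'; have [s [t st]] := valP (f, w); have [s' [t' st']] := valP (f', w).
  by apply: le_saddle st st' => i j; exact: le_shapley_matrix.
have val01 f w : (forall w', 0 <= f w' <= 1) -> 0 <= val (f, w) <= 1.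
  move=> f01; have [s [t [sP tP]]] := valP (f, w).
  have M01 i j : 0 <= shapley_matrix lambda f w i j <= 1.
    have /andP[g0 g1] := payoff_in01 w i j.
    have q0 : 0 <= \sum_w' transition w i j w' * f w'.
      by apply: ge_dist_average => w'; case/andP: (f01 w').
    have q1 : \sum_w' transition w i j w' * f w' <= 1.
      by apply: le_dist_average => w'; case/andP: (f01 w').
    rewrite addr_ge0 ?mulr_ge0 //= /shapley_matrix.
    by rewrite -[leRHS](subrKC lambda 1) lerD // ler_piMr.
  apply/andP; split.
    have /card_gt0P[i0 _] := act1_nonempty G.
    by apply: le_trans (tP i0); apply: ge_dist_average => j; case/andP: (M01 i0 j).
  have /card_gt0P[j0 _] := act2_nonempty G.
  by apply: le_trans (sP j0) _; apply: le_dist_average => i; case/andP: (M01 i j0).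
pose sub := [set f : Omega -> R |
  (forall w, 0 <= f w <= 1) /\ (forall w, f w <= val (f, w))].
pose V w := sup [set f w | f in sub].
have sub0 : sub (fun=> 0).
  split=> w; first by rewrite lexx ler01.
  by have /andP[] := @val01 (fun=> 0) w (fun=> ltac:(by rewrite lexx ler01)).
have V_ub w : has_ubound [set f w | f in sub].
  by exists 1 => _ [f [f01 _] <-]; case/andP: (f01 w).
have le_V f w : sub f -> f w <= V w by move=> subf; apply: ub_le_sup => //; exists f.
have V_le w c : (forall f, sub f -> f w <= c) -> V w <= c.
  by move=> fc; apply: ge_sup; [exists 0, (fun=> 0)|move=> _ [f subf <-]; exact: fc].
have V01 w : 0 <= V w <= 1.
  by rewrite (le_V _ w sub0) /= V_le // => f [/(_ w)/andP[]].
have V_sub w : V w <= val (V, w).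
  apply: V_le => f subf; apply: le_trans (proj2 subf w) _.
  by apply: val_mono => w'; exact: le_V.
have V_fix w : val (V, w) = V w.
  apply/eqP; rewrite eq_le V_sub andbT.
  apply: (le_V (fun w => val (V, w))); split=> w'; first exact: val01.
  exact: val_mono.
have [x xP] := choice (fun w => valP (V, w)); have [y yP] := choice xP.
by exists V, x, y; split=> // w; have := yP w; rewrite V_fix.
Qed.

Section BehaviourPayoff.
Variables (sigma : behaviour1 G) (tau : behaviour2 G).

Definition partial_payoff (n : nat) (h : history G) w : R :=
  \sum_(m < n) lambda * (1 - lambda) ^+ m * expected_payoff sigma tau m h w.

Lemma partial_payoffS n h w : partial_payoff n.+1 h w =
  bilinear (fun i j => lambda * payoff w i j + (1 - lambda) *
    \sum_w' transition w i j w' * partial_payoff n (rcons h (w, i, j)) w')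
    (sigma h w) (tau h w).
Proof.
rewrite /partial_payoff big_ord_recl expr0 mulr1 /= payoff_mixedE.
rewrite bilinearD !bilinearZ; congr (_ + _).
rewrite [LHS](eq_bigr (fun m : 'I_n => (1 - lambda) * bilinear
    (fun i j => \sum_w' transition w i j w' * (lambda * (1 - lambda) ^+ m *
       expected_payoff sigma tau m (rcons h (w, i, j)) w')) (sigma h w) (tau h w))).
  rewrite -mulr_sumr; congr (_ * _); rewrite exchange_big; apply: eq_bigr => i _.
  rewrite exchange_big; apply: eq_bigr => j _; rewrite -mulr_sumr; congr (_ * _).
  by rewrite exchange_big; apply: eq_bigr => w' _; rewrite mulr_sumr.
move=> m _; rewrite exprS (mulrCA lambda) -mulrA; congr (_ * _).
rewrite mulr_sumr; apply: eq_bigr => i _; rewrite mulr_sumr.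
apply: eq_bigr => j _; rewrite mulrCA; congr (_ * _).
by rewrite mulr_sumr; apply: eq_bigr => w' _; exact: mulrCA.
Qed.

Lemma expected_payoff01 m h w : 0 <= expected_payoff sigma tau m h w <= 1.
Proof.
elim: m h w => [|m IHm] h w; first exact: payoff_mixed01.
have E01 i j : 0 <= \sum_w' transition w i j w' *
    expected_payoff sigma tau m (rcons h (w, i, j)) w' <= 1.
  apply/andP; split.
    by apply: ge_dist_average => w'; have /andP[] := IHm (rcons h (w, i, j)) w'.
  by apply: le_dist_average => w'; have /andP[] := IHm (rcons h (w, i, j)) w'.
rewrite -[expected_payoff _ _ _ _ _]/(bilinear (fun i j => \sum_w' transition w i j w' *
  expected_payoff sigma tau m (rcons h (w, i, j)) w') (sigma h w) (tau h w)).
apply/andP; split.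
  rewrite -[leLHS](bilinear_cst 0 (sigma h w) (tau h w)); apply: le_bilinear => i j.
  by case/andP: (E01 i j).
rewrite -[leRHS](bilinear_cst 1 (sigma h w) (tau h w)); apply: le_bilinear => i j.
by case/andP: (E01 i j).
Qed.

Lemma partial_payoff_le1 n h w : partial_payoff n h w <= 1.
Proof.
elim: n h w => [|n IHn] h w; first by rewrite /partial_payoff big_ord0 ler01.
rewrite partial_payoffS -[leRHS](bilinear_cst 1 (sigma h w) (tau h w)).
apply: le_bilinear => i j; rewrite -[leRHS](subrKC lambda 1).
have /andP[_ g1] := payoff_in01 w i j.
by rewrite lerD // ler_piMr //; apply: le_dist_average => w'.
Qed.

Lemma partial_payoff_cvg w :
  partial_payoff n [::] w @[n --> \oo] --> discounted_payoff lambda w sigma tau.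
Proof.
have E : (fun n => partial_payoff n [::] w) = series (fun m =>
    lambda * (1 - lambda) ^+ m * expected_payoff sigma tau m [::] w).
  by apply/funext => n; rewrite /series /= big_mkord.
rewrite /discounted_payoff E; apply: nondecreasing_is_cvgn.
  apply/nondecreasing_seqP => n; rewrite seriesSr lerDl.
  by rewrite !mulr_ge0 ?exprn_ge0 //; case/andP: (expected_payoff01 n [::] w).
by exists 1 => _ [n _ <-]; rewrite -E partial_payoff_le1.
Qed.

Lemma discounted_payoff01 w : 0 <= discounted_payoff lambda w sigma tau <= 1.
Proof.
apply/andP; split.
  apply: (cvgr_to_ge (@partial_payoff_cvg w)); apply: nearW => n.
  apply: sumr_ge0 => m _; rewrite !mulr_ge0 ?exprn_ge0 //.
  by case/andP: (expected_payoff01 m [::] w).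
apply: (cvgr_to_le (@partial_payoff_cvg w)); apply: nearW => n.
exact: partial_payoff_le1.
Qed.

(** The factor [c] serves as a sign, so that the statement covers both
    subsolutions and supersolutions of the Shapley equation. *)
Lemma discounted_payoff_comparison (c : R) (V : Omega -> R) :
  (forall h w, c * V w <=
     c * bilinear (shapley_matrix lambda V w) (sigma h w) (tau h w)) ->
  forall w, c * V w <= c * discounted_payoff lambda w sigma tau.
Proof.
move=> Vsub w.
have [K VK] : exists K, forall w', c * V w' <= K.
  exists (\sum_w `|c * V w|) => w'.
  by rewrite (le_trans (ler_norm _)) // (bigD1 w') //= lerDl sumr_ge0.
have step n : forall h w', c * V w' <=
    c * partial_payoff n h w' + (1 - lambda) ^+ n * K.
  elim: n => [|n IHn] h w'; first by rewrite /partial_payoff big_ord0 mulr0 add0r mul1r.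
  apply: le_trans (Vsub h w') _; rewrite partial_payoffS -!bilinearZ.
  rewrite -[X in _ <= _ + X](bilinear_cst _ (sigma h w') (tau h w')) -bilinearD.
  apply: le_bilinear => i j; rewrite /shapley_matrix !mulrDr -addrA lerD2l.
  rewrite exprS -(mulrA (1 - lambda)) !(mulrCA c) -mulrDr ler_wpM2l //.
  rewrite -[X in _ <= _ + X]mul1r -[X in _ <= _ + X * _](dist_sum1 (transition w' i j)).
  rewrite !mulr_sumr mulr_suml -big_split /=; apply: ler_sum => w'' _.
  by rewrite mulrCA (mulrCA c) -mulrDr ler_wpM2l ?dist_ge0.
have lim_bound : c * partial_payoff n [::] w + (1 - lambda) ^+ n * K @[n --> \oo]
    --> c * discounted_payoff lambda w sigma tau + 0 * K.
  apply: cvgD; first by apply: cvgMl_tmp; exact: partial_payoff_cvg.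
  by apply: cvgMr_tmp; exact: cvg_expr.
rewrite -[leRHS]addr0 -(mul0r K); apply: (cvgr_to_ge lim_bound).
by apply: nearW => n; exact: step.
Qed.

End BehaviourPayoff.
Arguments partial_payoff : clear implicits.

Definition gamma w x y : R :=
  discounted_payoff lambda w (fun _ => x) (fun _ => y).

Lemma gamma01 w x y : 0 <= gamma w x y <= 1.
Proof. exact: discounted_payoff01. Qed.

Lemma gamma_comparison c V x y :
  (forall w, c * V w <= c * shapley lambda x y V w) ->
  forall w, c * V w <= c * gamma w x y.
Proof. by move=> Vsub; apply: discounted_payoff_comparison => h w. Qed.

Lemma expected_payoff_stationary x y m h w :
  expected_payoff (fun _ => x) (fun _ => y) m h w =
  \sum_w' (transition_mx x y ^+ m) (enum_rank w) (enum_rank w') *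
    payoff_mixed w' (x w') (y w').
Proof.
elim: m h w => [|m IHm] h w /=.
  rewrite expr0 (bigD1 w) //= mxE eqxx mul1r big1 ?addr0 // => w' /negPf ww'.
  by rewrite mxE (inj_eq enum_rank_inj) eq_sym ww' mul0r.
under eq_bigr => i _ do under eq_bigr => j _ do under eq_bigr => w' _ do rewrite IHm.
rewrite exprS.
transitivity (\sum_w1 transition_mixed w (x w) (y w) w1 *
   \sum_w' (transition_mx x y ^+ m) (enum_rank w1) (enum_rank w') *
    payoff_mixed w' (x w') (y w')).
  under [RHS]eq_bigr => w1 _ do rewrite mulr_suml.
  rewrite [RHS]exchange_big; apply: eq_bigr => i _.
  under [RHS]eq_bigr => w1 _ do rewrite mulr_suml.
  rewrite [RHS]exchange_big; apply: eq_bigr => j _.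
  by rewrite mulr_sumr; apply: eq_bigr => w1 _; rewrite mulrA.
under [LHS]eq_bigr => w1 _ do rewrite mulr_sumr.
rewrite exchange_big; apply: eq_bigr => w' _.
rewrite mxE mulr_suml [RHS](reindex (@enum_rank Omega)); last first.
  by apply: onW_bij; exact: enum_rank_bij.
by apply: eq_bigr => w1 _; rewrite !mxE !enum_rankK mulrA.
Qed.

(** The matrix formula sums, state by state, the series whose total is the
    expected discounted payoff; each of them converges because its partial sums
    are nonnegative and bounded by those of the total. *)
Lemma gammaE w x y : stationary_payoff lambda w x y = gamma w x y.
Proof.
pose u w' m := lambda * (1 - lambda) ^+ m *
  (transition_mx x y ^+ m) (enum_rank w) (enum_rank w') *
  payoff_mixed w' (x w') (y w').
have Q_ge0 m k l : 0 <= (transition_mx x y ^+ m) k l.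
  elim: m k l => [|m IHm] k l; first by rewrite expr0 mxE ler0n.
  rewrite exprS mxE; apply: sumr_ge0 => k' _; rewrite mulr_ge0 // mxE.
  by apply: sumr_ge0 => i _; apply: sumr_ge0 => j _; rewrite !mulr_ge0 ?dist_ge0.
have u_ge0 w' m : 0 <= u w' m.
  by rewrite !mulr_ge0 ?exprn_ge0 //; case/andP: (payoff_mixed01 w' (x w') (y w')).
have sum_u n : \sum_w' series (u w') n =
    partial_payoff (fun _ => x) (fun _ => y) n [::] w.
  rewrite /series /= exchange_big /= big_mkord; apply: eq_bigr => m _.
  rewrite expected_payoff_stationary mulr_sumr.
  by apply: eq_bigr => w' _; rewrite !mulrA.
have series_ge0 w' n : 0 <= series (u w') n by apply: sumr_ge0.
have u_cvg w' : cvgn (series (u w')).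
  apply: nondecreasing_is_cvgn.
    by apply/nondecreasing_seqP => n; rewrite seriesSr lerDl.
  exists 1 => _ [n _ <-].
  apply: le_trans (partial_payoff_le1 (fun _ => x) (fun _ => y) n [::] w).
  by rewrite -sum_u (bigD1 w') //= lerDl sumr_ge0.
have : \sum_w' series (u w') n @[n --> \oo] --> stationary_payoff lambda w x y.
  by apply: cvg_big => [|w' _]; [exact: add_continuous|exact: u_cvg].
rewrite (eq_cvg _ _ sum_u) => lim_u.
exact: (cvg_unique _ lim_u (@partial_payoff_cvg _ _ w)).
Qed.

Lemma gamma_fixed_point w x y :
  gamma w x y = shapley lambda x y (fun w' => gamma w' x y) w.
Proof.
pose P n w' := partial_payoff (fun _ => x) (fun _ => y) n [::] w'.
have P_cvg w' : P n w' @[n --> \oo] --> gamma w' x y by exact: partial_payoff_cvg.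
have PS n : P n.+1 w = shapley lambda x y (P n) w.
  rewrite /P partial_payoffS; apply: eq_bigr => i _; apply: eq_bigr => j _.
  congr (_ * (_ + _ * _)); apply: eq_bigr => w' _; congr (_ * _).
  by apply: eq_bigr => m _; rewrite !expected_payoff_stationary.
have : P n.+1 w @[n --> \oo] --> shapley lambda x y (fun w' => gamma w' x y) w.
  rewrite (eq_cvg _ _ PS).
  apply: cvg_big => [|i _]; first exact: add_continuous.
  apply: cvg_big => [|j _]; first exact: add_continuous.
  apply: cvgMl_tmp; apply: cvgD; first exact: cvg_cst.
  apply: cvgMl_tmp; apply: cvg_big => [|w' _]; first exact: add_continuous.
  by apply: cvgMl_tmp.
have lim_shift : [sequence P n.+1 w]_n @ \oo --> gamma w x y.
  by rewrite (cvg_shiftS (P^~ w)); exact: P_cvg.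
by move=> lim_P; exact: (cvg_unique _ lim_shift lim_P).
Qed.

(** The strategies that are optimal in the matrix games of Shapley's equation
    are optimal, as stationary strategies, against all behaviour strategies, so
    the value of the discounted game solves the equation. *)
Lemma discounted_valueP : exists x y,
  (forall w, saddle (shapley_matrix lambda (discounted_value G lambda) w)
     (discounted_value G lambda w) (x w) (y w)) /\
  (forall w, 0 <= discounted_value G lambda w <= 1).
Proof.
have [V [x [y [V01 xyV]]]] := shapley_equation.
have VE w : discounted_value G lambda w = V w.
  apply: (@saddle_is_value _ _ _ _ (fun _ => x) (fun _ => y)) => [sigma tau|tau|sigma].
  - exact: discounted_payoff01.
  - rewrite -[leLHS]mul1r -[leRHS]mul1r; apply: discounted_payoff_comparison => h w'.
    by rewrite !mul1r bilinear_cols; apply: ge_dist_average; case: (xyV w').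
  - rewrite -lerN2 -mulN1r -[leRHS]mulN1r.
    apply: discounted_payoff_comparison => h w'.
    by rewrite !mulN1r lerN2 bilinear_rows; apply: le_dist_average; case: (xyV w').
have -> : discounted_value G lambda = V by exact/funext.
by exists x, y.
Qed.

End DiscountedGame.

(** * Stationary replies and interior strategies *)

Lemma uniform_ge0 (R : realType) (X : finType) (x : X) : 0 <= (#|X|%:R)^-1 :> R.
Proof. by rewrite invr_ge0 ler0n. Qed.

Lemma uniform_sum1 (R : realType) (X : finType) : (0 < #|X|)%N ->
  \sum_(x : X) (#|X|%:R)^-1 = 1 :> R.
Proof.
by move=> X0; rewrite sumr_const -[LHS]mulr_natl divff // pnatr_eq0 -lt0n.
Qed.

Definition uniform_dist (R : realType) (X : finType) (X0 : (0 < #|X|)%N) : dist R X :=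
  Dist (@uniform_ge0 R X) (uniform_sum1 R X0).

Section StationaryReplies.
Variables (R : realType) (G : stochastic_game R).
Local Notation Omega := (state G).
Local Notation I := (act1 G).
Local Notation J := (act2 G).
Implicit Types (w : Omega) (x : stationary1 G) (y : stationary2 G).
Implicit Types (b : {ffun Omega -> J}).

Definition pure_strategy b : stationary2 G := fun w => pure_action R (b w).

Lemma bilinear_pure (A : I -> J -> R) (s : dist R I) (j : J) :
  bilinear A s (pure_action R j) = \sum_i s i * A i j.
Proof. by rewrite bilinear_cols sum_pure. Qed.

Lemma shapleyE lambda x y f w : shapley lambda x y f w =
  lambda * payoff_mixed w (x w) (y w) +
  (1 - lambda) * \sum_w' transition_mixed w (x w) (y w) w' * f w'.
Proof.
rewrite /shapley /shapley_matrix bilinearD !bilinearZ; congr (_ + _ * _).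
under [RHS]eq_bigr => w1 _ do rewrite mulr_suml.
rewrite [RHS]exchange_big; apply: eq_bigr => i _.
under [RHS]eq_bigr => w1 _ do rewrite mulr_suml.
rewrite [RHS]exchange_big; apply: eq_bigr => j _.
by rewrite mulr_sumr; apply: eq_bigr => w1 _; rewrite mulrA.
Qed.

Lemma transition_mixed_sum1 w s t : \sum_w' @transition_mixed R G w s t w' = 1.
Proof.
rewrite -(bilinear_cst 1 s t) exchange_big; apply: eq_bigr => i _.
by rewrite exchange_big; apply: eq_bigr => j _; rewrite -mulr_sumr dist_sum1.
Qed.

Variable lambda : R.
Hypothesis lambda01 : 0 < lambda <= 1.

Lemma le_gamma V x y : (forall w, V w <= shapley lambda x y V w) ->
  forall w, V w <= gamma lambda w x y.
Proof.
move=> Vsub w; rewrite -[leLHS]mul1r -[leRHS]mul1r.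
by apply: gamma_comparison => // w'; rewrite !mul1r.
Qed.

Lemma ge_gamma V x y : (forall w, shapley lambda x y V w <= V w) ->
  forall w, gamma lambda w x y <= V w.
Proof.
move=> Vsup w; rewrite -lerN2 -mulN1r -[leRHS]mulN1r.
by apply: gamma_comparison => // w'; rewrite !mulN1r lerN2.
Qed.

Lemma le_shapley x y f f' w : (forall w', f w' <= f' w') ->
  shapley lambda x y f w <= shapley lambda x y f' w.
Proof. by move=> ff'; apply: le_bilinear => i j; exact: le_shapley_matrix. Qed.

(** Policy improvement: a pure stationary reply that minimises the sum of the
    payoffs over all initial states admits no profitable change of action in
    any state, so its payoff is a subsolution against every reply. *)
Lemma pure_best_reply x : exists b : {ffun Omega -> J}, forall y w,
  gamma lambda w x (pure_strategy b) <= gamma lambda w x y.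
Proof.
have /card_gt0P[j1 _] := act2_nonempty G.
pose total b := \sum_w gamma lambda w x (pure_strategy b).
have [b _ bmin] := @arg_minP _ _ _ [ffun=> j1] predT total isT.
exists b; pose u w := gamma lambda w x (pure_strategy b).
have u_le w0 j0 : u w0 <= \sum_i x w0 i * shapley_matrix lambda u w0 i j0.
  rewrite leNgt; apply/negP => lt_u.
  pose b' := [ffun w => if w == w0 then j0 else b w].
  have b'w0 : shapley lambda x (pure_strategy b') u w0 < u w0.
    by rewrite /shapley /pure_strategy ffunE eqxx bilinear_pure.
  have b'u w : shapley lambda x (pure_strategy b') u w <= u w.
    have [->|ww0] := eqVneq w w0; first exact: ltW.
    rewrite [leRHS]/u (gamma_fixed_point lambda01) /shapley /pure_strategy.
    by rewrite ffunE (negPf ww0).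
  have le_b' := ge_gamma b'u.
  have lt_b' : gamma lambda w0 x (pure_strategy b') < u w0.
    apply: le_lt_trans b'w0; rewrite (gamma_fixed_point lambda01).
    exact: le_shapley.
  have := bmin b' isT; rewrite leNgt => /negP; apply.
  by rewrite /total (bigD1 w0) //= [ltRHS](bigD1 w0) //= ltr_leD // ler_sum.
move=> y; apply: le_gamma => w.
by rewrite /shapley bilinear_cols; apply: ge_dist_average => j; exact: u_le.
Qed.

Lemma optimal_stationary2 :
  exists y, forall x w, gamma lambda w x y <= discounted_value G lambda w.
Proof.
have [x0 [y [xyV _]]] := discounted_valueP G lambda01.
exists y => x; apply: ge_gamma => w; rewrite /shapley bilinear_rows.
by apply: le_dist_average; case: (xyV w).
Qed.

(** Mixing an optimal stationary strategy with a small uniform perturbation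
    costs at most the perturbation divided by the discount factor. *)
Lemma near_optimal_interior : exists x : stationary1 G,
  (forall w i, 0 < x w i) /\
  (forall y w, discounted_value G lambda w - lambda <= gamma lambda w x y).
Proof.
have /andP[l0 l1] := lambda01.
have [x [y0 [xV V01]]] := discounted_valueP G lambda01.
set V := discounted_value G lambda in xV V01.
have h01 : 0 <= lambda ^+ 2 <= 1 by rewrite sqr_ge0 expr_le1 // ltW.
pose x' : stationary1 G := fun w => mixture h01 (x w) (uniform_dist R (act1_nonempty G)).
exists x'; split=> [w i|y].
  rewrite /= ltr_wpDl ?mulr_ge0 ?dist_ge0 ?subr_ge0 ?mulr_gt0 ?exprn_gt0 ?invr_gt0 //.
    by have /andP[] := h01.
  by rewrite ltr0n act1_nonempty.
(* Lowering [V] by [lambda] creates a slack of [lambda ^+ 2] in Shapley's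
   inequality, which absorbs the perturbation of that size. *)
apply: (@le_gamma (fun w => V w - lambda)) => w; rewrite /shapley bilinear_cols.
apply: ge_dist_average => j.
have shift i : shapley_matrix lambda (fun w' => V w' - lambda) w i j =
    shapley_matrix lambda V w i j - (1 - lambda) * lambda.
  rewrite /shapley_matrix -addrA -mulrBr; congr (_ + _ * _).
  under eq_bigr do rewrite mulrBr.
  by rewrite sumrB -mulr_suml dist_sum1 mul1r.
have M0 i : 0 <= shapley_matrix lambda V w i j.
  have /andP[g0 _] := payoff_in01 w i j.
  rewrite addr_ge0 ?mulr_ge0 ?subr_ge0 ?(ltW l0) //.
  by apply: ge_dist_average => w'; case/andP: (V01 w').
have avg0 : 0 <= \sum_i uniform_dist R (act1_nonempty G) i * shapley_matrix lambda V w i j.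
  exact: ge_dist_average.
have /andP[_ V1] := V01 w; have [/(_ j) xj _] := xV w.
under eq_bigr do rewrite shift.
under eq_bigr do rewrite mulrBr.
rewrite sumrB -mulr_suml dist_sum1 mul1r sum_mixture.
have /andP[h0 h1] := h01.
have := ler_wpM2l (_ : 0 <= 1 - lambda ^+ 2) xj; rewrite subr_ge0 => /(_ h1) xj'.
have := mulr_ge0 h0 avg0 => avg0'.
have := ler_wpM2l h0 V1 => V1'.
by lra.
Qed.

(** Dividing the fixed-point equation by [1 - lambda] leaves a single
    parameter [lambda / (1 - lambda)] and no subtraction. *)
Lemma gamma_balance x y w : lambda < 1 ->
  gamma lambda w x y * (lambda / (1 - lambda) +
     \sum_w' transition_mixed w (x w) (y w) w') =
  lambda / (1 - lambda) * payoff_mixed w (x w) (y w) +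
  \sum_w' transition_mixed w (x w) (y w) w' * gamma lambda w' x y.
Proof.
move=> l1; rewrite transition_mixed_sum1.
have mu0 : 1 - lambda != 0 by rewrite subr_eq0 gt_eqF.
have -> : lambda / (1 - lambda) + 1 = (1 - lambda)^-1 by field.
rewrite {1}(gamma_fixed_point lambda01) shapleyE.
by field.
Qed.
End StationaryReplies.

(** * Posynomials and the elimination of states *)

Section Posynomials.
Variables (R : realType) (K : finType).
Implicit Types (z : K -> R) (m : {ffun K -> nat}) (f g : (K -> R) -> R).
Implicit Types (s : seq (R * {ffun K -> nat})).

Definition monomial m z : R := \prod_k z k ^+ m k.

Definition posynomial_eval s z : R := \sum_(t <- s) t.1 * monomial t.2 z.

Definition posynomial f : Prop := exists2 s, all (fun t => 0 < t.1) s &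
  forall z, f z = posynomial_eval s z.

Lemma monomial_gt0 m z : (forall k, 0 < z k) -> 0 < monomial m z.
Proof. by move=> z0; apply: prodr_gt0 => k _; rewrite exprn_gt0. Qed.

Lemma posynomial_ge0 f z : posynomial f -> (forall k, 0 < z k) -> 0 <= f z.
Proof.
move=> [s s0 ->] z0; rewrite /posynomial_eval big_seq; apply: sumr_ge0 => t ts.
by rewrite mulr_ge0 ?(ltW (monomial_gt0 _ z0)) // ltW // (allP s0).
Qed.

(** The zero function is the empty sum, since all coefficients are positive. *)
Lemma posynomial_cst c : 0 <= c -> posynomial (fun=> c).
Proof.
rewrite le_eqVlt => /orP[/eqP <-|c0].
  by exists [::] => // z; rewrite /posynomial_eval big_nil.
exists [:: (c, [ffun=> 0%N])] => [|z]; first by rewrite /= c0.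
rewrite /posynomial_eval big_seq1 /monomial big1 ?mulr1 // => k _.
by rewrite ffunE expr0.
Qed.

Lemma posynomial_var k : posynomial (fun z => z k).
Proof.
exists [:: (1, [ffun k' => (k' == k : nat)])] => [|z]; first by rewrite /= ltr01.
rewrite /posynomial_eval big_seq1 mul1r /monomial (bigD1 k) //= ffunE eqxx expr1.
by rewrite big1 ?mulr1 // => k' /negPf kk'; rewrite ffunE kk' expr0.
Qed.

Lemma posynomialD f g : posynomial f -> posynomial g ->
  posynomial (fun z => f z + g z).
Proof.
move=> [s s0 fs] [t t0 gt]; exists (s ++ t) => [|z]; first by rewrite all_cat s0.
by rewrite fs gt /posynomial_eval big_cat.
Qed.

Lemma posynomialM f g : posynomial f -> posynomial g ->
  posynomial (fun z => f z * g z).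
Proof.
move=> [s s0 fs] [t t0 gt].
pose mulm (p q : R * {ffun K -> nat}) : R * {ffun K -> nat} :=
  (p.1 * q.1, [ffun k => (p.2 k + q.2 k)%N]).
exists [seq mulm p q | p <- s, q <- t] => [|z].
  apply/allP => _ /allpairsP[[p q] [/= /(allP s0) p0 /(allP t0) q0 ->]].
  exact: mulr_gt0.
rewrite fs gt /posynomial_eval big_allpairs_dep mulr_suml; apply: eq_bigr => p _.
rewrite mulr_sumr; apply: eq_bigr => q _ /=.
have -> : monomial [ffun k => (p.2 k + q.2 k)%N] z = monomial p.2 z * monomial q.2 z.
  by rewrite -big_split; apply: eq_bigr => k _; rewrite ffunE exprD.
by rewrite mulrACA.
Qed.

Lemma posynomial_sum (X : finType) (P : pred X) (F : X -> (K -> R) -> R) :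
  (forall x, P x -> posynomial (F x)) -> posynomial (fun z => \sum_(x | P x) F x z).
Proof.
move=> FP; elim: (index_enum X) => [|x e IHe].
  have -> : (fun z => \sum_(x <- [::] | P x) F x z) = fun=> 0.
    by apply/funext => z; rewrite big_nil.
  exact: posynomial_cst.
case Px : (P x).
  have -> : (fun z => \sum_(i <- x :: e | P i) F i z) =
      fun z => F x z + \sum_(i <- e | P i) F i z.
    by apply/funext => z; rewrite big_cons Px.
  by apply: posynomialD => //; exact: FP.
have -> : (fun z => \sum_(i <- x :: e | P i) F i z) =
    fun z => \sum_(i <- e | P i) F i z; last exact: IHe.
by apply/funext => z; rewrite big_cons Px.
Qed.

(** Eliminating the states one at a time from the balance equations of a
    Markov chain never requires a subtraction: the self-loop [a s s] cancels
    on both sides, and clearing the remaining denominator [B] leaves balance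
    equations whose coefficients are again sums of products of the old ones. *)
Lemma state_elimination (Omega : finType) (S : {set Omega}) (w : Omega)
    (a : Omega -> Omega -> (K -> R) -> R) (kill reward : Omega -> (K -> R) -> R) :
  w \in S ->
  (forall w1 w2, posynomial (a w1 w2)) ->
  (forall w1, posynomial (kill w1)) -> (forall w1, posynomial (reward w1)) ->
  (forall w1 z, (forall k, 0 < z k) -> 0 < kill w1 z) ->
  exists N D, [/\ posynomial N, posynomial D,
    forall z, (forall k, 0 < z k) -> 0 < D z &
    forall z (u : Omega -> R), (forall k, 0 < z k) ->
      (forall w1, w1 \in S -> u w1 * (kill w1 z + \sum_(w2 in S) a w1 w2 z) =
         reward w1 z + \sum_(w2 in S) a w1 w2 z * u w2) ->
      u w * D z = N z].
Proof.
move En : #|S| => n; elim: n S En a kill reward => [|n IHn] S En a kill reward wS aP kP rP k0.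
  by move: wS; rewrite (cards0_eq En) inE.
have [S1|[s]] := set_0Vmem (S :\ w).
  exists (reward w), (kill w); split=> // [z z0|z u z0 /(_ w wS)]; first exact: k0.
  rewrite !(big_setD1 w wS) /= S1 !big_set0 !addr0 mulrDr => /eqP.
  by rewrite (mulrC (a w w z)) (inj_eq (addIr _)) => /eqP.
rewrite in_setD1 => /andP[sw sS].
pose B z := kill s z + \sum_(w2 in S :\ s) a s w2 z.
have BP : posynomial B by apply: posynomialD => //; exact: posynomial_sum.
have B0 z : (forall k, 0 < z k) -> 0 < B z.
  by move=> z0; rewrite ltr_wpDr ?k0 // sumr_ge0 // => w2 _; exact: posynomial_ge0.
have cardS' : #|S :\ s| = n by move: En; rewrite (cardsD1 s) sS => -[].
have [|||||N [D [NP DP D0 ND]]] := IHn (S :\ s) cardS'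
    (fun w1 w2 z => B z * a w1 w2 z + a w1 s z * a s w2 z)
    (fun w1 z => B z * kill w1 z + a w1 s z * kill s z)
    (fun w1 z => B z * reward w1 z + a w1 s z * reward s z) _ _ _ _ _.
- by rewrite in_setD1 wS eq_sym sw.
- by move=> w1 w2; apply: posynomialD; exact: posynomialM.
- by move=> w1; apply: posynomialD; exact: posynomialM.
- by move=> w1; apply: posynomialD; exact: posynomialM.
- move=> w1 z z0; rewrite ltr_wpDr ?mulr_gt0 ?B0 ?k0 //.
  by rewrite mulr_ge0 ?(ltW (k0 _ _ z0)) //; exact: posynomial_ge0.
exists N, D; split=> // z u z0 sys; apply: ND => // w1; rewrite in_setD1 => /andP[_ w1S].
have := sys s sS; have := sys w1 w1S.
rewrite !(big_setD1 s sS) /= => sys_w1 sys_s.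
have us : u s * B z = reward s z + \sum_(w2 in S :\ s) a s w2 z * u w2.
  apply: (addrI (u s * a s s z)); rewrite /B -mulrDr addrCA sys_s.
  by rewrite (mulrC (u s)) addrCA.
rewrite !big_split /= -!mulr_sumr.
under [in RHS]eq_bigr do rewrite mulrDl.
rewrite big_split /=.
under [X in _ = _ + (X + _)]eq_bigr do rewrite -mulrA.
under [X in _ = _ + (_ + X)]eq_bigr do rewrite -mulrA.
rewrite -!mulr_sumr.
transitivity (B z * (u w1 * (kill w1 z + (a w1 s z + \sum_(w2 in S :\ s) a w1 w2 z)))).
  by rewrite /B; ring.
rewrite sys_w1.
transitivity (B z * reward w1 z + a w1 s z * (u s * B z) +
   B z * \sum_(w2 in S :\ s) a w1 w2 z * u w2); first by ring.
by rewrite us; ring.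
Qed.
End Posynomials.

(** * Exponents extracted from an ultrafilter *)

Section Exponents.
Variables (R : realType) (K : finType).
Implicit Types (alpha e b : K -> R).

Definition dot alpha e : R := \sum_k alpha k * e k.

(** The linear form [alpha] behaves along the family [l] as it does along the
    logarithms [b k + e k * ln lambda] of power laws when lambda tends to 0. *)
Definition follows (T : Type) (F : set_system T) (l : T -> K -> R) e b alpha : Prop :=
  [/\ dot alpha e = 0 -> dot alpha (l t) @[t --> F] --> dot alpha b,
      0 < dot alpha e -> dot alpha (l t) @[t --> F] --> -oo &
      dot alpha e < 0 -> dot alpha (l t) @[t --> F] --> +oo].

Lemma dotB alpha e e' : dot alpha (fun k => e k - e' k) = dot alpha e - dot alpha e'.
Proof. by rewrite -sumrB; apply: eq_bigr => k _; rewrite mulrBr. Qed.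

Lemma dotZ alpha c e : dot alpha (fun k => c * e k) = c * dot alpha e.
Proof. by rewrite mulr_sumr; apply: eq_bigr => k _; rewrite mulrCA. Qed.

Lemma ultra_trichotomy (T : Type) (U : set_system T) {UU : UltraFilter U} (f : T -> R) :
  [\/ exists r : R, f t @[t --> U] --> r, f t @[t --> U] --> -oo | f t @[t --> U] --> +oo].
Proof.
have [nearNy|] := pselect (forall M, \forall t \near U, f t <= M).
  by apply: Or32; apply/cvgrNyPle.
move=> /existsNP[M1 M1P].
have [neary|] := pselect (forall M, \forall t \near U, M <= f t).
  by apply: Or33; apply/cvgryPge.
move=> /existsNP[M2 M2P]; apply: Or31.
apply: (@ultra_cvg_segment R T U UU f M1 M2).
have [//|U1] := in_ultra_setVsetC [set t | f t <= M1] UU.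
have [//|U2] := in_ultra_setVsetC [set t | M2 <= f t] UU.
near=> t; apply/andP; split.
  have : ~ (f t <= M1) by near: t.
  by move/negP; rewrite -ltNge => /ltW.
have : ~ (M2 <= f t) by near: t.
by move/negP; rewrite -ltNge => /ltW.
Unshelve. all: by end_near. Qed.

(** Correcting [l t] by the bounded vector [b t] that accounts for all forms
    with a finite limit leaves a vector on which these forms vanish while the
    others still tend to infinity; a single generic [t] then provides the
    exponents. *)
Lemma ultra_exponents (T : Type) (U : set_system T) {UU : UltraFilter U} (A : finType)
    (l : T -> K -> R) (alpha : A -> K -> R) :
  exists e b, forall a, follows U l e b (alpha a).
Proof.
pose s a t := dot (alpha a) (l t).
pose fin a := exists r : R, s a t @[t --> U] --> r.
(* The columns of [M] are the forms with a finite limit, the others being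
   replaced by 0; [pinvmx M] then solves, linearly in the right-hand side, the
   system that prescribes the values of the former. *)
pose M : 'M[R]_(#|K|, #|A|) := \matrix_(k, a)
  if `[< fin (enum_val a) >] then alpha (enum_val a) (enum_val k) else 0.
pose ofrow (v : 'rV[R]_#|K|) k := v 0 (enum_rank k).
have ME (v : 'rV[R]_#|K|) a : (v *m M) 0 (enum_rank a) =
    if `[< fin a >] then dot (alpha a) (ofrow v) else 0.
  rewrite mxE; case: ifPn => fa; last first.
    by apply: big1 => k _; rewrite mxE enum_rankK (negPf fa) mulr0.
  rewrite /dot (reindex (@enum_val K predT)); last first.
    by apply: onW_bij; exact: enum_val_bij.
  by apply: eq_bigr => k _; rewrite mxE enum_rankK fa /ofrow enum_valK mulrC.
pose L t : 'rV[R]_#|K| := \row_k l t (enum_val k).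
have LE t : ofrow (L t) = l t by apply/funext => k; rewrite /ofrow mxE enum_rankK.
pose bt t := ofrow (L t *m M *m pinvmx M).
have bt_fin t a : fin a -> dot (alpha a) (bt t) = s a t.
  move=> fa; have := congr1 (fun v : 'rV[R]_#|A| => v 0 (enum_rank a))
    (mulmxKpV (submxMl (L t) M)).
  by rewrite /= !ME (asboolT fa) LE.
have rE a : exists r : R, fin a -> s a t @[t --> U] --> r.
  by have [[r ra]|nfa] := pselect (fin a); [exists r|exists 0].
have [r rP] := choice rE.
pose rv : 'rV[R]_#|A| := \row_a if `[< fin (enum_val a) >] then r (enum_val a) else 0.
pose b := ofrow (rv *m pinvmx M).
have bt_cvg k : bt t k @[t --> U] --> b k.
  rewrite /bt /b /ofrow mxE; under eq_fun do rewrite mxE.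
  apply: cvg_big => [|a _]; first exact: add_continuous.
  apply: cvgMr_tmp; rewrite -(enum_valK a) mxE enum_rankK.
  under eq_fun do rewrite ME.
  by case: asboolP => fa; [under eq_fun do rewrite LE; exact: rP|exact: cvg_cst].
have dot_bt_cvg a : dot (alpha a) (bt t) @[t --> U] --> dot (alpha a) b.
  apply: cvg_big => [|k _]; first exact: add_continuous.
  by apply: cvgMl_tmp; exact: bt_cvg.
pose et t k := bt t k - l t k.
have etE a t : dot (alpha a) (et t) = dot (alpha a) (bt t) - s a t by rewrite dotB.
have signs a : \forall t \near U,
    [\/ fin a, 0 < dot (alpha a) (et t) /\ s a t @[t --> U] --> -oo |
        dot (alpha a) (et t) < 0 /\ s a t @[t --> U] --> +oo].
  have [fa|sNy|sy] := ultra_trichotomy (s a); first by apply: nearW => t; exact: Or31.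
    near=> t; apply: Or32; split=> //; rewrite etE subr_gt0.
    apply: (@le_lt_trans _ _ (dot (alpha a) b - 1)); near: t.
      by move/cvgrNyPle: sNy; exact.
    by apply: (cvgr_gt _ (dot_bt_cvg a)); rewrite ltrBlDr ltrDl.
  near=> t; apply: Or33; split=> //; rewrite etE subr_lt0.
  apply: (@lt_le_trans _ _ (dot (alpha a) b + 1)); near: t.
    by apply: (cvgr_lt _ (dot_bt_cvg a)); rewrite ltrDl.
  by move/cvgryPge: sy; exact.
have [t tP] := filter_ex (filter_forall _ signs).
exists (et t), b => a.
have [fa|[gt0 sNy]|[lt0 sy]] := tP a.
- have et0 : dot (alpha a) (et t) = 0 by rewrite etE bt_fin // subrr.
  split; rewrite et0 ?ltxx // => _.
  under eq_fun do rewrite -[dot _ _]/(s a _) -bt_fin //; exact: dot_bt_cvg.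
- by split=> //; [move=> /eqP; rewrite gt_eqF|rewrite ltNge ltW].
- by split=> //; [move=> /eqP; rewrite lt_eqF|rewrite ltNge ltW].
Unshelve. all: by end_near. Qed.

Definition unit_form (k0 k : K) : R := (k == k0)%:R.

Lemma dot_unit_form k0 e : dot (unit_form k0) e = e k0.
Proof.
rewrite /dot (bigD1 k0) //= /unit_form eqxx mul1r big1 ?addr0 // => k /negPf ->.
by rewrite mul0r.
Qed.

Lemma cvg_not_infinite (T : Type) (F : set_system T) {FF : ProperFilter F} (f : T -> R) (r : R) :
  f t @[t --> F] --> r -> f t @[t --> F] --> -oo -> False.
Proof.
move=> fr /cvgrNyPle /(_ (r - 1)) fle.
have : r <= r - 1 by exact: cvgr_to_le fr fle.
by rewrite leNgt ltrBlDr ltrDl ltr01.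
Qed.

(** The pairs (e, b) can be rescaled, e by a positive factor, and b can be
    shifted by a multiple of e, without changing the conclusion of
    [ultra_exponents]; this makes the coordinate [k0] follow the parameter
    itself, with exponent 1 and coefficient 1. *)
Lemma normalised_exponents (T : Type) (U : set_system T) {UU : UltraFilter U} (A : finType)
    (l : T -> K -> R) (alpha : A -> K -> R) (a0 : A) (k0 : K) :
  alpha a0 = unit_form k0 -> l t k0 @[t --> U] --> -oo ->
  exists e b, [/\ e k0 = 1, b k0 = 0 & forall a, follows U l e b (alpha a)].
Proof.
move=> a0E lNy; have [e [b ebP]] := ultra_exponents l alpha.
have ek0 : 0 < e k0.
  have [fin0 _ finy] := ebP a0; move: fin0 finy; rewrite a0E !dot_unit_form.
  have dl t : dot (unit_form k0) (l t) = l t k0 by exact: dot_unit_form.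
  rewrite (eq_cvg _ _ dl) (eq_cvg _ _ dl) => fin0 finy.
  case: (ltgtP (e k0) 0) => // [/finy ly|/fin0 l0].
    have [t []] := filter_ex (filterI (proj1 (cvgrNyPle _) lNy 0) (proj1 (cvgryPge _) ly 1)).
    lra.
  by case: (cvg_not_infinite l0 lNy).
exists (fun k => (e k0)^-1 * e k), (fun k => b k - b k0 / e k0 * e k); split.
- by rewrite mulVf // gt_eqF.
- by rewrite divfK ?subrr // gt_eqF.
move=> a; have [fin0 finNy finy] := ebP a.
split; rewrite dotZ.
- move=> /eqP; rewrite mulf_eq0 invr_eq0 gt_eqF //= => /eqP e0.
  by rewrite dotB dotZ e0 mulr0 subr0; exact: fin0.
- by rewrite pmulr_rgt0 ?invr_gt0.
- by rewrite pmulr_rlt0 ?invr_gt0.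
Qed.

End Exponents.

(** * Limits of ratios of posynomials *)

Section LimitsOfRatios.
Variables (R : realType) (K : finType).
Implicit Types (e b : K -> R) (m : {ffun K -> nat}) (s : seq (R * {ffun K -> nat})).

Definition weighted_degree e m : R := \sum_k (m k)%:R * e k.

Definition exponent_gap m m' : K -> R := fun k => (m k)%:R - (m' k)%:R.

Lemma dot_exponent_gap m m' e : dot (exponent_gap m m') e = weighted_degree e m - weighted_degree e m'.
Proof. by rewrite -sumrB; apply: eq_bigr => k _; rewrite mulrBl. Qed.

Definition exp_point (l : K -> R) : K -> R := fun k => expR (l k).

Lemma exp_point_gt0 l k : 0 < exp_point l k.
Proof. exact: expR_gt0. Qed.

Lemma monomial_exp m l : monomial m (exp_point l) = expR (weighted_degree l m).
Proof.
rewrite expR_sum; apply: eq_bigr => k _.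
by rewrite -expRM_natl.
Qed.

Lemma monomial_ratio m m' l :
  monomial m (exp_point l) / monomial m' (exp_point l) = expR (dot (exponent_gap m m') l).
Proof. by rewrite !monomial_exp dot_exponent_gap expRB. Qed.

Lemma expR_cvgNy (T : Type) (F : set_system T) {FF : Filter F} (f : T -> R) :
  f t @[t --> F] --> -oo -> expR (f t) @[t --> F] --> 0.
Proof.
move=> /cvgNry fy.
have := cvg_comp _ _ fy (@cvgr_expR R).
by under eq_cvg do rewrite /= fctE opprK.
Qed.

(** When [m] has the lowest degree, this is the limit of the posynomial divided
    by [m]: the monomials of higher degree become negligible. *)
Definition leading_coef e b s m : R :=
  \sum_(t <- s | weighted_degree e t.2 == weighted_degree e m) t.1 * expR (dot (exponent_gap t.2 m) b).

Section Filters.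
Variables (T : Type) (F : set_system T) (FF : Filter F) (l : T -> K -> R).

Lemma scaled_posynomial_cvg e b s m :
  {in s, forall t, follows F l e b (exponent_gap t.2 m) /\ weighted_degree e m <= weighted_degree e t.2} ->
  posynomial_eval s (exp_point (l x)) / monomial m (exp_point (l x)) @[x --> F]
    --> leading_coef e b s m.
Proof.
move=> sP; rewrite /leading_coef big_mkcond.
have E x : posynomial_eval s (exp_point (l x)) / monomial m (exp_point (l x)) =
    \sum_(t <- s | t \in s) t.1 * expR (dot (exponent_gap t.2 m) (l x)).
  rewrite /posynomial_eval mulr_suml [LHS]big_seq; apply: eq_bigr => t _.
  by rewrite -mulrA monomial_ratio.
rewrite (eq_cvg _ _ E) big_seq.
apply: cvg_big => [|t ts]; first exact: add_continuous.
have [[fin Ny _] le_m] := sP t ts.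
case: ifPn => [/eqP e0|ne].
  apply: cvgMl_tmp; apply: (continuous_cvg _ (@continuous_expR R _)).
  by apply: fin; rewrite dot_exponent_gap e0 subrr.
rewrite -[0](mulr0 t.1); apply: cvgMl_tmp; apply: expR_cvgNy; apply: Ny.
by rewrite dot_exponent_gap subr_gt0 lt_def ne.
Qed.

End Filters.

Lemma leading_coef_gt0 e b s m : all (fun t => 0 < t.1) s -> m \in map snd s ->
  0 < leading_coef e b s m.
Proof.
move=> /allP s0 /mapP[t ts ->]; rewrite /leading_coef big_mkcond (big_rem t ts) /= eqxx.
rewrite ltr_pwDl ?mulr_gt0 ?expR_gt0 ?s0 //.
rewrite -big_mkcond big_seq_cond; apply: sumr_ge0 => t' /andP[/mem_rem t's _].
by rewrite mulr_ge0 ?expR_ge0 // ltW // s0.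
Qed.

Lemma seq_argmin (X : eqType) (s : seq X) (f : X -> R) : s != [::] ->
  exists2 x, x \in s & {in s, forall y, f x <= f y}.
Proof.
elim: s => // x s IHs _; have [->|/IHs[y ys ymin]] := eqVneq s [::].
  by exists x => [|y]; rewrite inE // => /eqP ->.
have [xy|/ltW yx] := leP (f x) (f y).
  exists x => [|u]; first exact: mem_head.
  by rewrite inE => /orP[/eqP -> //|/ymin]; exact: le_trans.
exists y => [|u]; first by rewrite inE ys orbT.
by rewrite inE => /orP[/eqP -> //|/ymin].
Qed.

(** Divided by the monomial of lowest degree in the denominator, a ratio of
    posynomials has a limit that can be read off the exponents [e] and the
    coefficients [b], hence is the same along all families that follow them. *)
Lemma posynomial_ratio_transfer (T T' : Type) (U : set_system T) (F : set_system T')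
    {PU : ProperFilter U} {FF : Filter F} (l : T -> K -> R) (l' : T' -> K -> R)
    e b (sN sD : seq (R * {ffun K -> nat})) (g : R) :
  all (fun t => 0 < t.1) sN -> all (fun t => 0 < t.1) sD -> sD != [::] ->
  {in map snd (sN ++ sD) &, forall m m',
    follows U l e b (exponent_gap m m') /\ follows F l' e b (exponent_gap m m')} ->
  posynomial_eval sN (exp_point (l x)) / posynomial_eval sD (exp_point (l x))
    @[x --> U] --> g ->
  posynomial_eval sN (exp_point (l' x)) / posynomial_eval sD (exp_point (l' x))
    @[x --> F] --> g.
Proof.
move=> sN0 sD0 sDn fol limU.
have [m0 m0D m0min] : exists2 m0, m0 \in map snd sD &
    {in map snd sD, forall m, weighted_degree e m0 <= weighted_degree e m}.
  by apply: seq_argmin; case: (sD) sDn.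
have memN m : m \in map snd sN -> m \in map snd (sN ++ sD).
  by rewrite map_cat mem_cat => ->.
have memD m : m \in map snd sD -> m \in map snd (sN ++ sD).
  by rewrite map_cat mem_cat orbC => ->.
have d0 := leading_coef_gt0 e b sD0 m0D.
have D_U : posynomial_eval sD (exp_point (l x)) / monomial m0 (exp_point (l x)) @[x --> U]
    --> leading_coef e b sD m0.
  apply: scaled_posynomial_cvg => t ts; have tD := map_f snd ts.
  by split; [apply: (proj1 (fol _ _ _ _)); exact: memD|exact: m0min].
have D_F : posynomial_eval sD (exp_point (l' x)) / monomial m0 (exp_point (l' x)) @[x --> F]
    --> leading_coef e b sD m0.
  apply: scaled_posynomial_cvg => t ts; have tD := map_f snd ts.
  by split; [apply: (proj2 (fol _ _ _ _)); exact: memD|exact: m0min].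
have mono_gt0 m v : 0 < monomial m (exp_point v) :> R.
  by apply: monomial_gt0 => k; exact: exp_point_gt0.
have mono_neq0 m v : monomial m (exp_point v) != 0 :> R by rewrite gt_eqF.
have eval_gt0 v : 0 < posynomial_eval sD (exp_point v).
  case: (sD) sDn sD0 => // t s _ /= /andP[t0 s0].
  rewrite /posynomial_eval big_cons ltr_pwDl ?mulr_gt0 //.
  rewrite big_seq; apply: sumr_ge0 => t' t's.
  by rewrite mulr_ge0 ?ltW // (allP s0).
have eval_neq0 v : posynomial_eval sD (exp_point v) != 0 by rewrite gt_eqF.
(* A monomial of the numerator of lower degree would make the ratio
   unbounded along [U]. *)
have le_N t : t \in sN -> weighted_degree e m0 <= weighted_degree e t.2.
  move=> ts; rewrite leNgt; apply/negP => lt_t.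
  have tN := memN _ (map_f snd ts).
  have ratio0 : monomial m0 (exp_point (l x)) / monomial t.2 (exp_point (l x)) @[x --> U]
      --> (0 : R).
    under eq_fun do rewrite monomial_ratio; apply: expR_cvgNy.
    have [[_ Ny _] _] := fol m0 t.2 (memD _ m0D) tN.
    by apply: Ny; rewrite dot_exponent_gap subr_gt0.
  have lim0 : posynomial_eval sN (exp_point (l x)) / monomial t.2 (exp_point (l x))
      @[x --> U] --> g * (leading_coef e b sD m0 * 0).
    have E v : posynomial_eval sN (exp_point v) / monomial t.2 (exp_point v) =
        posynomial_eval sN (exp_point v) / posynomial_eval sD (exp_point v) *
        (posynomial_eval sD (exp_point v) / monomial m0 (exp_point v) *
         (monomial m0 (exp_point v) / monomial t.2 (exp_point v))).
      by field; rewrite !mono_neq0 eval_neq0.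
    by under eq_fun do rewrite E; apply: cvgM limU (cvgM D_U ratio0).
  have t1 : 0 < t.1 by exact: (allP sN0).
  have : t.1 <= g * (leading_coef e b sD m0 * 0).
    apply: (cvgr_to_ge lim0); apply: nearW => x; rewrite ler_pdivlMr //.
    rewrite /posynomial_eval (big_rem t ts) /= lerDl big_seq; apply: sumr_ge0 => t' t's.
    by rewrite mulr_ge0 ?ltW // (allP sN0) // (mem_rem t's).
  by rewrite !mulr0 leNgt t1.
have N_U : posynomial_eval sN (exp_point (l x)) / monomial m0 (exp_point (l x)) @[x --> U]
    --> leading_coef e b sN m0.
  apply: scaled_posynomial_cvg => t ts; have tN := memN _ (map_f snd ts).
  by split; [apply: (proj1 (fol _ _ _ _)) => //; exact: memD|exact: le_N].
have N_F : posynomial_eval sN (exp_point (l' x)) / monomial m0 (exp_point (l' x)) @[x --> F]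
    --> leading_coef e b sN m0.
  apply: scaled_posynomial_cvg => t ts; have tN := memN _ (map_f snd ts).
  by split; [apply: (proj2 (fol _ _ _ _)) => //; exact: memD|exact: le_N].
have ratioE v : posynomial_eval sN (exp_point v) / posynomial_eval sD (exp_point v) =
    posynomial_eval sN (exp_point v) / monomial m0 (exp_point v) *
    (posynomial_eval sD (exp_point v) / monomial m0 (exp_point v))^-1.
  by field; rewrite mono_neq0 eval_neq0.
have dn0 : leading_coef e b sD m0 != 0 by rewrite gt_eqF.
have limU' : posynomial_eval sN (exp_point (l x)) / posynomial_eval sD (exp_point (l x))
    @[x --> U] --> leading_coef e b sN m0 / leading_coef e b sD m0.
  by under eq_fun do rewrite ratioE; apply: cvgM N_U (cvgV dn0 D_U).
rewrite (cvg_unique _ limU limU') //.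
by under eq_fun do rewrite ratioE; apply: cvgM N_F (cvgV dn0 D_F).
Qed.

End LimitsOfRatios.

(** * Canonical strategies *)

Lemma follows_power_law (R : realType) (K : finType) (l d : R -> K -> R) (e b alpha : K -> R) :
  (\forall lambda \near 0^'+, forall k, l lambda k = d lambda k + e k * ln lambda) ->
  (forall k, d lambda k @[lambda --> 0^'+] --> b k) ->
  follows (0 : R)^'+ l e b alpha.
Proof.
move=> lE dP.
have lE' : \forall lambda \near (0 : R)^'+,
    dot alpha (l lambda) = dot alpha (d lambda) + dot alpha e * ln lambda.
  near=> lambda.
  have lEl : forall k, l lambda k = d lambda k + e k * ln lambda by near: lambda.
  rewrite /dot mulr_suml -big_split /=; apply: eq_bigr => k _.
  by rewrite lEl mulrDr mulrA.
have dot_d : dot alpha (d lambda) @[lambda --> 0^'+] --> dot alpha b.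
  apply: cvg_big => [|k _]; first exact: add_continuous.
  by apply: cvgMl_tmp.
split.
- move=> e0; apply: cvg_trans dot_d; apply: near_eq_cvg.
  by near=> lambda; rewrite (near lE' lambda) // e0 mul0r addr0.
- move=> e0; apply/cvgrNyPle => M; near=> lambda.
  rewrite (near lE' lambda) //.
  have d1 : dot alpha (d lambda) <= dot alpha b + 1.
    by near: lambda; apply: (cvgr_le _ dot_d); rewrite ltrDl.
  have ln1 : ln lambda <= (M - (dot alpha b + 1)) / dot alpha e.
    by near: lambda; move/cvgrNyPle: (@lnNy R); exact.
  by move: ln1; rewrite ler_pdivlMr // mulrC; lra.
- move=> e0; apply/cvgryPge => M; near=> lambda.
  rewrite (near lE' lambda) //.
  have d1 : dot alpha b - 1 <= dot alpha (d lambda).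
    by near: lambda; apply: (cvgr_ge _ dot_d); rewrite ltrBlDr ltrDl.
  have ln1 : ln lambda <= (M - (dot alpha b - 1)) / dot alpha e.
    by near: lambda; move/cvgrNyPle: (@lnNy R); exact.
  by move: ln1; rewrite ler_ndivlMr // mulrC; lra.
Unshelve. all: by end_near. Qed.

Lemma ln_one_minus_cvg (R : realType) :
  - ln (1 - lambda) @[lambda --> (0 : R)^'+] --> (0 : R).
Proof.
have : - ln (1 - lambda) @[lambda --> (0 : R)^'+] --> - ln (1 - (0 : R)).
  apply: cvgN; apply: continuous_cvg.
    by apply: continuous_ln; rewrite subr0 ltr01.
  apply: cvgB; first exact: cvg_cst.
  by apply: (@cvg_at_right_filter R R id); exact: cvg_id.
by rewrite subr0 ln1 oppr0.
Qed.

Lemma ln_discount_ratio (R : realType) : \forall lambda \near (0 : R)^'+,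
  ln (lambda / (1 - lambda)) = - ln (1 - lambda) + ln lambda.
Proof.
near=> lambda.
have /andP[l0 l1] : 0 < lambda < 1 by apply/andP.
by rewrite ln_div ?posrE ?subr_gt0 // addrC.
Unshelve. all: by end_near. Qed.

Section GameAsPosynomials.
Variables (R : realType) (G : stochastic_game R).
Local Notation Omega := (state G).
Local Notation I := (act1 G).
Local Notation J := (act2 G).
Local Notation K := (option (Omega * I)).

(** The point at which the posynomials that represent the payoffs are
    evaluated, the discount factor being the extra coordinate [None]. *)
Definition game_point (lambda : R) (x : Omega -> I -> R) : K -> R := fun k =>
  if k is Some wi then x wi.1 wi.2 else lambda / (1 - lambda).

Lemma gamma_posynomial (w : Omega) (b : {ffun Omega -> J}) :
  exists sN sD : seq (R * {ffun K -> nat}),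
  [/\ all (fun t => 0 < t.1) sN, all (fun t => 0 < t.1) sD, sD != [::] &
   forall lambda (x : stationary1 G), 0 < lambda < 1 -> (forall w i, 0 < x w i) ->
     gamma lambda w x (pure_strategy b) =
     posynomial_eval sN (game_point lambda x) / posynomial_eval sD (game_point lambda x)].
Proof.
pose a w1 w2 (z : K -> R) := \sum_i z (Some (w1, i)) * transition w1 i (b w1) w2.
pose kill (w1 : Omega) (z : K -> R) := z None.
pose reward w1 (z : K -> R) := z None * \sum_i z (Some (w1, i)) * payoff w1 i (b w1).
have [|||||N [D [[sN sN0 NE] [sD sD0 DE] D0 ND]]] :=
    @state_elimination R K Omega (finset.finset predT) w a kill reward.
- by rewrite inE.
- move=> w1 w2; apply: posynomial_sum => i _; apply: posynomialM.
    exact: posynomial_var.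
  by apply: posynomial_cst; exact: dist_ge0.
- by move=> w1; exact: posynomial_var.
- move=> w1; apply: posynomialM; first exact: posynomial_var.
  apply: posynomial_sum => i _; apply: posynomialM; first exact: posynomial_var.
  by apply: posynomial_cst; case/andP: (payoff_in01 w1 i (b w1)).
- by move=> w1 z; exact.
exists sN, sD; split=> // [|lambda x /andP[l0 l1] x0].
  apply/eqP => sDE; have := D0 (fun=> 1) (fun=> ltr01).
  by rewrite DE sDE /posynomial_eval big_nil ltxx.
have z0 k : 0 < game_point lambda x k.
  by case: k => [[w1 i]|] /=; rewrite ?x0 // divr_gt0 // subr_gt0.
have l01 : 0 < lambda <= 1 by rewrite l0 ltW.
rewrite -NE -DE -(ND _ (fun w1 => gamma lambda w1 x (pure_strategy b)) z0).
  by rewrite mulfK // gt_eqF // D0.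
have aE w1 w2 : a w1 w2 (game_point lambda x) =
    transition_mixed w1 (x w1) (pure_strategy b w1) w2.
  by symmetry; exact: (bilinear_pure (fun i j => transition w1 i j w2) (x w1) (b w1)).
have sumE (F : Omega -> R) : \sum_(w2 in finset.finset predT) F w2 = \sum_w2 F w2.
  by apply: eq_bigl => w2; rewrite inE.
move=> w1 _; rewrite !sumE.
have rE : reward w1 (game_point lambda x) =
    lambda / (1 - lambda) * payoff_mixed w1 (x w1) (pure_strategy b w1).
  by rewrite payoff_mixedE bilinear_pure.
rewrite rE; under eq_bigr do rewrite aE.
under [X in _ = _ + X]eq_bigr do rewrite aE.
exact: gamma_balance.
Qed.

Section CanonicalStrategies.
Variable p : canonical_param G.

Definition canonical_exponent (k : K) : R :=
  if k is Some (w, i) then expo p w i else 1.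

Definition canonical_log_coef (k : K) : R :=
  if k is Some (w, i) then ln (coef p w i) else 0.

Lemma canonical_weight_sum_cvg w :
  \sum_i canonical_weight p lambda w i @[lambda --> (0 : R)^'+] --> (1 : R).
Proof.
rewrite -(coef_sum1 p w) big_mkcond.
apply: cvg_big => [|i _]; first exact: add_continuous.
rewrite /canonical_weight; case: eqP => [->|/eqP ei].
  by under eq_fun do rewrite powRr0 mulr1; exact: cvg_cst.
have : coef p w i * lambda `^ expo p w i @[lambda --> (0 : R)^'+] --> coef p w i * 0.
  by apply: cvgMl_tmp; apply: powR_cvg0; rewrite lt_def ei expo_ge0.
by rewrite mulr0.
Qed.

(** The normalising sums tend to 1 by [canonical_weight_sum_cvg], and
    lambda / (1 - lambda) is equivalent to lambda, so both are invisible in the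
    limit. *)
Lemma canonical_follows (alpha : K -> R) : follows (0 : R)^'+
  (fun lambda k => ln (game_point lambda (canonical_prob p lambda) k))
  canonical_exponent canonical_log_coef alpha.
Proof.
pose W lambda w := \sum_i canonical_weight p lambda w i.
pose d lambda (k : K) := if k is Some (w, i) then ln (coef p w i) - ln (W lambda w)
  else - ln (1 - lambda).
apply: (@follows_power_law _ _ _ d) => [|[[w i]|]] /=.
- near=> lambda => -[[w i]|] /=; last by rewrite (near (ln_discount_ratio R) lambda) // mul1r.
  have l0 : 0 < lambda by [].
  rewrite /canonical_prob ln_div ?posrE ?canonical_weight_gt0 //; last first.
    exact: canonical_weight_sum_gt0.
  rewrite /canonical_weight lnM ?posrE ?coef_gt0 ?powR_gt0 // ln_powR.
  by rewrite addrAC.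
- have : ln (coef p w i) - ln (W lambda w) @[lambda --> (0 : R)^'+] -->
      ln (coef p w i) - ln 1.
    apply: cvgB; first exact: cvg_cst.
    apply: continuous_cvg (canonical_weight_sum_cvg w).
    by apply: continuous_ln; rewrite ltr01.
  by rewrite ln1 subr0.
- exact: ln_one_minus_cvg.
Unshelve. all: by end_near. Qed.

End CanonicalStrategies.

(** Replacing near-optimal strategies by the power laws that mimic them along
    [U] preserves the limit payoff against each of the finitely many pure
    stationary replies, and the power laws make sense for all small lambda. *)
Lemma canonical_from_ultrafilter (U : set_system R) {UU : UltraFilter U}
    (L : Omega -> R) : (0 : R)^'+ `<=` U ->
  (forall w, discounted_value G lambda w @[lambda --> U] --> L w) ->
  exists p : canonical_param G, forall eps w, 0 < eps ->
    \forall lambda \near 0^'+, forall (lambda_gt0 : 0 < lambda) y,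
      L w - eps <= gamma lambda w (canonical_strategy p lambda_gt0) y.
Proof.
move=> U0 vL.
have nearU (P : set R) : (\forall lambda \near 0^'+, P lambda) -> U P by exact: U0.
have near01 : \forall lambda \near (0 : R)^'+, 0 < lambda < 1.
  by near=> lambda; apply/andP.
have xs_ex lambda : exists x : stationary1 G, 0 < lambda < 1 ->
    (forall w i, 0 < x w i) /\
    (forall y w, discounted_value G lambda w - lambda <= gamma lambda w x y).
  have [/andP[l0 /ltW l1]|nl] := boolP (0 < lambda < 1); last first.
    by exists (fun=> uniform_dist R (act1_nonempty G)).
  have [x [x0 xv]] := @near_optimal_interior R G lambda (introT andP (conj l0 l1)).
  by exists x.
have [xs xsP] := choice xs_ex.
have point_gt0 lambda (x : Omega -> I -> R) : 0 < lambda < 1 ->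
    (forall w i, 0 < x w i) -> forall k, 0 < game_point lambda x k.
  by move=> /andP[l0 l1] x0 [[w1 i]|] /=; rewrite ?x0 // divr_gt0 // subr_gt0.
have ln_point lambda (x : Omega -> I -> R) : 0 < lambda < 1 ->
    (forall w i, 0 < x w i) ->
    exp_point (fun k => ln (game_point lambda x k)) = game_point lambda x.
  move=> l01 x0; apply/funext => k; rewrite /exp_point lnK //.
  by rewrite posrE point_gt0.
pose l lambda k := ln (game_point lambda (xs lambda) k).
have [sN sNP] := choice (fun wb : Omega * {ffun Omega -> J} =>
  gamma_posynomial wb.1 wb.2).
have [sD sND] := choice sNP.
pose unitm k0 : {ffun K -> nat} := [ffun k => (k == k0 : nat)].
(* All monomials to be compared. The constant monomial and the variables are
   included in order to control each probability by itself. *)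
pose ms : seq {ffun K -> nat} := [ffun=> 0%N] :: [seq unitm k | k <- enum {: K}] ++
  flatten [seq map snd (sN wb ++ sD wb) | wb <- enum {: Omega * {ffun Omega -> J}}].
have ms0 : [ffun=> 0%N] \in ms by rewrite inE eqxx.
have msu k : unitm k \in ms.
  by rewrite inE mem_cat map_f ?mem_enum // orbT.
have msND wb m : m \in map snd (sN wb ++ sD wb) -> m \in ms.
  move=> mwb; rewrite inE mem_cat orbA; apply/orP; right.
  by apply/flatten_mapP; exists wb; rewrite ?mem_enum.
have unitE k : exponent_gap R (unitm k) [ffun=> 0%N] = unit_form R k.
  by apply/funext => k'; rewrite /exponent_gap !ffunE subr0.
have lNone : l lambda None @[lambda --> U] --> -oo.
  apply/cvgrNyPle => M; apply: nearU; near=> lambda.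
  rewrite /l /= (near (ln_discount_ratio R) lambda) //.
  have d1 : - ln (1 - lambda) <= 1.
    by near: lambda; apply: (cvgr_le _ (@ln_one_minus_cvg R)); rewrite ltr01.
  have ln1 : ln lambda <= M - 1.
    by near: lambda; move/cvgrNyPle: (@lnNy R); exact.
  by lra.
pose alpha (a : seq_sub ms * seq_sub ms) : K -> R := exponent_gap R (ssval a.1) (ssval a.2).
have [e [b [e1 b0 ebP]]] := @normalised_exponents R K R U UU _ l alpha
  (SeqSub (msu None), SeqSub ms0) None (unitE None) lNone.
have fol m m' : m \in ms -> m' \in ms -> follows U l e b (exponent_gap R m m').
  by move=> mm mm'; exact: (ebP (SeqSub mm, SeqSub mm')).
have folk k : follows U l e b (unit_form R k) by rewrite -unitE; exact: fol.
have x_gt0 lambda w i : 0 < lambda < 1 -> 0 < xs lambda w i.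
  by move=> /xsP[+ _]; exact.
have x_le1 lambda w i : xs lambda w i <= 1.
  rewrite -(dist_sum1 (xs lambda w)) (bigD1 i) //= lerDl.
  by apply: sumr_ge0 => ? _; exact: dist_ge0.
(* A negative exponent would make a probability tend to infinity, and the
   actions of exponent 0 are those that keep a positive probability. *)
have e_ge0 w i : 0 <= e (Some (w, i)).
  rewrite leNgt; apply/negP => e0.
  have [_ _] := folk (Some (w, i)); rewrite dot_unit_form => /(_ e0).
  move=> /cvgryPge /(_ 1) near1.
  have near0 : \forall lambda \near U, l lambda (Some (w, i)) <= 0.
    apply: nearU; near=> lambda; rewrite /l /= ln_le0 //.
  have [lambda []] := filter_ex (filterI near1 near0).
  by rewrite dot_unit_form; lra.
have x_cvg w i : xs lambda w i @[lambda --> U] -->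
    (if e (Some (w, i)) == 0 then expR (b (Some (w, i))) else 0).
  have [fin Ny _] := folk (Some (w, i)).
  have expl : \forall lambda \near U,
      expR (dot (unit_form R (Some (w, i))) (l lambda)) = xs lambda w i.
    apply: nearU; near=> lambda; rewrite dot_unit_form /l /= lnK // posrE.
    by apply: x_gt0; near: lambda.
  case: eqP => [ek0|/eqP ek0].
    apply: cvg_trans (near_eq_cvg expl) _.
    apply: continuous_cvg; first exact: continuous_expR.
    by rewrite -(dot_unit_form _ b); apply: fin; rewrite dot_unit_form.
  apply: cvg_trans (near_eq_cvg expl) _; apply: expR_cvgNy; apply: Ny.
  by rewrite dot_unit_form lt_def ek0 e_ge0.
have coef_sum w : \sum_(i | e (Some (w, i)) == 0) expR (b (Some (w, i))) = 1.
  have : \sum_i xs lambda w i @[lambda --> U] -->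
      \sum_i (if e (Some (w, i)) == 0 then expR (b (Some (w, i))) else 0).
    by apply: cvg_big => [|i _]; [exact: add_continuous|exact: x_cvg].
  under eq_fun do rewrite dist_sum1.
  rewrite -big_mkcond => lim1; apply: cvg_unique lim1 _ => //; exact: cvg_cst.
pose p := CanonicalParam (fun w i => expR_gt0 (b (Some (w, i)))) e_ge0 coef_sum.
exists p.
pose l' lambda k := ln (game_point lambda (canonical_prob p lambda) k).
have fol' alpha' : follows (0 : R)^'+ l' e b alpha'.
  have eE : canonical_exponent p = e by apply/funext => -[[w i]|].
  have bE : canonical_log_coef p = b.
    by apply/funext => -[[w i]|] //=; rewrite expRK.
  by rewrite -eE -bE; exact: canonical_follows.
have ratio_cvg w bb : exists2 g, L w <= g &
    posynomial_eval (sN (w, bb)) (exp_point (l' lambda)) /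
    posynomial_eval (sD (w, bb)) (exp_point (l' lambda)) @[lambda --> (0 : R)^'+] --> g.
  have [sN0 sD0 sDn gammaE] := sND (w, bb).
  have gamma_near : \forall lambda \near (0 : R)^'+,
      gamma lambda w (xs lambda) (pure_strategy bb) =
      posynomial_eval (sN (w, bb)) (exp_point (l lambda)) /
      posynomial_eval (sD (w, bb)) (exp_point (l lambda)).
    near=> lambda; have l01 : 0 < lambda < 1 by near: lambda.
    have [x0 _] := xsP lambda l01.
    by rewrite gammaE // /l ln_point.
  have [g g_lim] : exists g : R,
      gamma lambda w (xs lambda) (pure_strategy bb) @[lambda --> U] --> g.
    apply: (@ultra_cvg_segment _ _ _ _ _ 0 1); apply: nearU; near=> lambda.
    have /andP[l0 l1] : 0 < lambda < 1 by near: lambda.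
    by apply: gamma01; rewrite l0 ltW.
  exists g.
    have v_lim : discounted_value G lambda w - lambda @[lambda --> U] --> L w - 0.
      apply: cvgB; first exact: vL.
      apply: cvg_trans (_ : lambda @[lambda --> (0 : R)^'+] --> (0 : R)).
        by move=> P; exact: nearU.
      by apply: (@cvg_at_right_filter R R id); exact: cvg_id.
    rewrite -[leLHS]subr0; apply: ler_cvg_to v_lim g_lim _; apply: nearU.
    near=> lambda; have l01 : 0 < lambda < 1 by near: lambda.
    by have [_] := xsP lambda l01; exact.
  apply: (@posynomial_ratio_transfer R K R R U (0 : R)^'+ _ _ l l' e b) => //.
    by move=> m m' /msND mm /msND m'm; split; [exact: fol|exact: fol'].
  by apply: cvg_trans g_lim; apply: near_eq_cvg; exact: nearU.
move=> eps w eps0.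
have near_ratio : \forall lambda \near (0 : R)^'+, forall bb,
    L w - eps <= posynomial_eval (sN (w, bb)) (exp_point (l' lambda)) /
    posynomial_eval (sD (w, bb)) (exp_point (l' lambda)).
  apply: filter_forall => bb; have [g Lg lim_g] := ratio_cvg w bb.
  by apply: (cvgr_ge _ lim_g); rewrite ltrBlDr (le_lt_trans Lg) // ltrDl.
near=> lambda => lambda_gt0 y.
have l01 : 0 < lambda < 1 by near: lambda.
have l01' : 0 < lambda <= 1 by case/andP: l01 => -> /ltW.
have [bb bbP] := pure_best_reply l01' (canonical_strategy p lambda_gt0).
apply: le_trans (bbP y w).
have [_ _ _ gammaE] := sND (w, bb).
have prob_gt0 w1 i : 0 < canonical_strategy p lambda_gt0 w1 i.
  by rewrite divr_gt0 ?canonical_weight_gt0 ?canonical_weight_sum_gt0.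
rewrite gammaE // -ln_point //.
by have : forall bb', _ := near near_ratio lambda; exact.
Unshelve. all: by end_near. Qed.

(** The canonical family guarantees at least L - eps, and player 2 can hold
    every strategy to the value. *)
Lemma value_lower_bound (U : set_system R) {UU : UltraFilter U}
    (L : Omega -> R) : (0 : R)^'+ `<=` U ->
  (forall w, discounted_value G lambda w @[lambda --> U] --> L w) ->
  forall eps w, 0 < eps ->
    \forall lambda \near 0^'+, L w - eps <= discounted_value G lambda w.
Proof.
move=> U0 vL eps w eps0; have [p pP] := canonical_from_ultrafilter U0 vL.
near=> lambda.
have l0 : 0 < lambda by [].
have l01 : 0 < lambda <= 1 by rewrite l0 /= ltW.
have [y yP] := optimal_stationary2 G l01.
apply: le_trans (yP (canonical_strategy p l0) w).
have strategy_ge : forall (l0 : 0 < lambda) y,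
    L w - eps <= gamma lambda w (canonical_strategy p l0) y.
  by near: lambda; exact: pP.
exact: strategy_ge.
Unshelve. all: by end_near. Qed.

Lemma value_along_ultrafilter (U : set_system R) {UU : UltraFilter U} :
  (0 : R)^'+ `<=` U ->
  exists L : Omega -> R, forall w, discounted_value G lambda w @[lambda --> U] --> L w.
Proof.
move=> U0.
have vL w : exists L : R, discounted_value G lambda w @[lambda --> U] --> L.
  apply: (@ultra_cvg_segment _ _ _ _ _ 0 1); apply: U0; near=> lambda.
  have l0 : 0 < lambda by [].
  have l01 : 0 < lambda <= 1 by rewrite l0 /= ltW.
  by have [x [y [_]]] := discounted_valueP G l01; exact.
by have [L LP] := choice vL; exists L.
Unshelve. all: by end_near. Qed.

End GameAsPosynomials.

Theorem theorem2p1 (R : realType) (G : stochastic_game R) :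
  (forall w : state G,
     cvg (discounted_value G lambda w @[lambda --> 0^'+])) /\
  exists x : canonical_param G, asymptotically_optimal x.
Proof.
have [U [UU U0]] := @ultraFilterLemma R (0 : R)^'+ _.
have [L LP] := value_along_ultrafilter G U0.
have v_cvg w : discounted_value G lambda w @[lambda --> 0^'+] --> L w.
  apply/cvgrPdist_le => eps eps0.
  have below := value_lower_bound U0 LP w eps0.
  have above : \forall lambda \near (0 : R)^'+, discounted_value G lambda w <= L w + eps.
    apply: contrapT => not_above.
    (* Otherwise an ultrafilter living on [B] would have a limit of the values
       exceeding [L w], which [value_lower_bound] turns into a lower bound along
       [U] as well. *)
    pose B := [set lambda | L w + eps < discounted_value G lambda w].
    have FB : ProperFilter (within B (0 : R)^'+).
      apply: Build_ProperFilter_ex => A AB; apply: contrapT => A0; apply: not_above.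
      have {}AB : \forall lambda \near (0 : R)^'+, B lambda -> A lambda by [].
      apply: filterS AB => lambda BA; rewrite leNgt; apply/negP => /BA ?.
      by apply: A0; exists lambda.
    have [V [VU V0]] := ultraFilterLemma FB.
    have V0' : (0 : R)^'+ `<=` V.
      move=> A A0; apply: V0.
      have {}A0 : \forall lambda \near (0 : R)^'+, A lambda by [].
      by apply: filterS A0 => lambda Al _.
    have [L' L'P] := value_along_ultrafilter G V0'.
    have L'_ge : L w + eps <= L' w.
      apply: (cvgr_to_ge (L'P w)); apply: V0.
      by apply: nearW => lambda; exact: ltW.
    have eps2 : 0 < eps / 2 by rewrite divr_gt0.
    have := U0 _ (value_lower_bound V0' L'P w eps2) => L'U.
    have : L' w - eps / 2 <= L w by apply: (cvgr_to_ge (LP w)); exact: L'U.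
    by lra.
  near=> lambda.
  have lower : L w - eps <= discounted_value G lambda w by near: lambda; exact: below.
  have upper : discounted_value G lambda w <= L w + eps by near: lambda; exact: above.
  by rewrite ler_distlC lower upper.
have limE w : limit_value w = L w by exact: cvg_lim (v_cvg w).
split=> [w|]; first by apply/cvg_ex; exists (L w).
have [p pP] := canonical_from_ultrafilter U0 LP.
exists p => eps eps0.
have near_all : \forall lambda \near (0 : R)^'+, forall w (l0 : 0 < lambda) y,
    L w - eps <= gamma lambda w (canonical_strategy p l0) y.
  by apply: filter_forall => w; exact: pP.
have [delta /= delta0 deltaP] := near_all.
exists (Num.min delta 1); split.
  by rewrite lt_min delta0 ltr01 /= ge_min lexx orbT.
move=> w y lambda l0; rewrite lt_min => /andP[l_delta l1].
rewrite limE gammaE; last by rewrite l0 ltW.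
by apply: deltaP => //=; rewrite sub0r normrN gtr0_norm.
Unshelve. all: by end_near. Qed.
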